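(* Fix $\beta>0$. For each $n$ let $n_1=n_1(n)$ and $n_2=n_2(n)$ be real numbers with $n_1,n_2>n-1$, and let $(\lambda_1,\dots,\lambda_n)\in[0,1]^n$ be distributed according to the $\beta$-Jacobi ensemble with parameters $n,n_1,n_2,\beta$. Let $f$ be a continuous function on $[0,1]$. Below, $\to_{\mathbb{P}}$ denotes convergence in probability as $n\to\infty$. (1) If $n_1+n_2-2n=o(n)$, then $$\frac1n\sum_{i=1}^n f(\lambda_i)\to_{\mathbb{P}}\frac1\pi\int_0^1\frac{f(x)}{\sqrt{x(1-x)}}\,dx.$$ (2) If $n_1/n\to p$ and $n_2/n\to q$ for some finite $p,q$, then $$\frac1n\sum_{i=1}^n f(\lambda_i)\to_{\mathbb{P}}\int_0^1 f(x)\,d\mu(x),$$ where $\mu$ has density $$d\mu(x)=\frac{p+q}{2\pi}\,\frac{\sqrt{-(x-\lambda_-)(x-\lambda_+)}}{x(1-x)}\,\mathbf 1_{[\lambda_-,\lambda_+]}(x)\,dx,\qquad \lambda_\pm=\left[\sqrt{\tfrac{p}{p+q}\left(1-\tfrac1{p+q}\right)}\pm\sqrt{\tfrac1{p+q}\left(1-\tfrac p{p+q}\right)}\right]^2 .$$ (3) If $(n_1+n_2-2n)/n\to\infty$ and $(n_1-n)/(n_1+n_2-2n)\to\lambda$, then $$\frac1n\sum_{i=1}^n f(\lambda_i)\to_{\mathbb{P}} f(\lambda).$$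
   Context: The $\beta$-Jacobi ensemble with parameters $n,n_1,n_2,\beta$ is the probability measure on $[0,1]^n$ with density $$\frac1Z\prod_i\lambda_i^{\frac\beta2[n_1-n+1]-1}(1-\lambda_i)^{\frac\beta2[n_2-n+1]-1}\prod_{i<j}|\lambda_i-\lambda_j|^\beta,$$ where $Z=Z(n,n_1,n_2,\beta)$ is the normalization constant. *)

(* Defs.v *)
From HB Require Import structures.
From mathcomp Require Import all_boot all_order all_algebra.
From mathcomp Require Import all_classical all_reals all_analysis.

Set Implicit Arguments.
Unset Strict Implicit.
Unset Printing Implicit Defensive.

Import Order.TTheory GRing.Theory Num.Theory.
Import numFieldNormedType.Exports.

Local Open Scope classical_set_scope.
Local Open Scope ring_scope.

(* The library's SigmaFiniteMeasure instance on [m1 \x m2] is keyed on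
   subprobabilities, so sigma-finiteness for general factors is not inferred. *)
Lemma product_sigma_finite d1 d2 (T1 : measurableType d1)
    (T2 : measurableType d2) (R : realType)
    (m1 : {sigma_finite_measure set T1 -> \bar R})
    (m2 : {sigma_finite_measure set T2 -> \bar R}) :
  sigma_finite setT (m1 \x m2)%E.
Proof.
have /sigma_finiteP[F [TF ndF Foo]] := sigma_finiteT m1.
have /sigma_finiteP[G [TG ndG Goo]] := sigma_finiteT m2.
exists (fun n => F n `*` G n).
  rewrite -setXTT TF TG predeqE => -[x y]; split.
    move=> [/= [n _ Fnx] [k _ Gky]]; exists (maxn n k) => //; split.
    - by move: x Fnx; exact/subsetPset/ndF/leq_maxl.
    - by move: y Gky; exact/subsetPset/ndG/leq_maxr.
  by move=> [n _ []/= ? ?]; split; exists n.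
move=> k; have [? ?] := Foo k; have [? ?] := Goo k.
split; first exact: measurableX.
by rewrite product_measure1E// lte_mul_pinfty// ge0_fin_numE.
Qed.

Section tuple_lebesgue.
Context {R : realType}.
Local Notation R' := (measurableTypeR R).

Definition tuple_cons n (x : R' * n.-tuple R') : n.+1.-tuple R' :=
  [tuple of x.1 :: x.2].

Lemma measurable_tuple_cons n : measurable_fun setT (@tuple_cons n).
Proof. exact: measurable_cons. Qed.

Section step.
Variables (n : nat) (m : {sigma_finite_measure set (n.-tuple R') -> \bar R}).

Definition lebesgue_cons : set (n.+1.-tuple R') -> \bar R :=
  pushforward (lebesgue_measure \x m)%E (@tuple_cons n).

Let lebesgue_cons0 : lebesgue_cons set0 = 0%E.
Proof. by rewrite /lebesgue_cons /pushforward preimage_set0 measure0. Qed.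

Let lebesgue_cons_ge0 A : (0 <= lebesgue_cons A)%E.
Proof. by rewrite /lebesgue_cons /pushforward measure_ge0. Qed.

Let lebesgue_cons_sigma_additive : semi_sigma_additive lebesgue_cons.
Proof.
by have := @measure_semi_sigma_additive _ _ _
  (@measure_function_pushforward__canonical__measure_function_Measure _ _ _ _ _
   (lebesgue_measure \x m)%E _ (@measurable_tuple_cons n)); apply.
Qed.

HB.instance Definition _ := isMeasure.Build _ _ _ lebesgue_cons
  lebesgue_cons0 lebesgue_cons_ge0 lebesgue_cons_sigma_additive.

Let lebesgue_cons_sigma_finite : sigma_finite setT lebesgue_cons.
Proof.
have [F FT Foo] := product_sigma_finite lebesgue_measure m.
pose uncons (t : n.+1.-tuple R') : R' * n.-tuple R' :=
  (thead t, [tuple of behead t]).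
have unconsK : cancel uncons (@tuple_cons n) by move=> t; rewrite [RHS]tuple_eta.
have consK : cancel (@tuple_cons n) uncons.
  by move=> [x t]; rewrite /uncons /tuple_cons /=; congr pair; exact: val_inj.
have muncons : measurable_fun setT uncons.
  apply/measurable_fun_pairP; split; first exact: measurable_tnth.
  exact: measurable_behead.
exists (fun k => uncons @^-1` F k).
  by rewrite -preimage_bigcup -FT preimage_setT.
move=> k; have [mF Fk] := Foo k; split.
  by rewrite -[X in measurable X]setTI; exact: muncons.
rewrite /lebesgue_cons /pushforward -comp_preimage.
by rewrite (_ : uncons \o _ = id)//; apply/funext => x /=; rewrite consK.
Qed.

HB.instance Definition _ := Measure_isSigmaFinite.Build _ _ _ lebesgue_cons
  lebesgue_cons_sigma_finite.

End step.

(* Lebesgue measure on R^n, with R^n represented by [n.-tuple R]. The type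
   [measurableTypeR R] is R with the sigma-algebra used by [lebesgue_measure]. *)
Fixpoint tuple_lebesgue_measure n :
    {sigma_finite_measure set (n.-tuple R') -> \bar R} :=
  if n is n'.+1 then lebesgue_cons (tuple_lebesgue_measure n')
  else dirac ([tuple] : 0.-tuple R').

Lemma tuple_lebesgue_measure_box n (A : 'I_n -> set R') :
  (forall i, measurable (A i)) ->
  tuple_lebesgue_measure n [set x | forall i, A i (tnth x i)] =
  (\prod_(i < n) lebesgue_measure (A i))%E.
Proof.
elim: n A => [|n IHn] A mA /=.
  by rewrite big_ord0 diracE mem_set//= => -[].
rewrite big_ord_recl -IHn// -product_measure1E//; last first.
  have -> : [set x : n.-tuple R' | forall i, A (lift ord0 i) (tnth x i)] =
      \bigcap_(i in [set: 'I_n]) ((fun x => tnth x i) @^-1` A (lift ord0 i)).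
    by apply/seteqP; split=> x h i; [move=> _; exact: h|exact: h].
  apply: fin_bigcap_measurable => // i _.
  by rewrite -[X in measurable X]setTI; exact: measurable_tnth.
rewrite /lebesgue_cons /pushforward; congr (_ \x _)%E.
apply/seteqP; split=> -[x t] /=.
  move=> h; split; first exact: (h ord0).
  by move=> i; have := h (lift ord0 i); rewrite tnthS.
by move=> [Ax At] i; case: (unliftP ord0 i) => [j ->|->//]; rewrite tnthS.
Qed.

End tuple_lebesgue.

Section jacobi_ensemble.
Context {R : realType}.

Definition unit_cube (n : nat) : set (n.-tuple (measurableTypeR R)) :=
  [set x | forall i, 0 <= (tnth x i : R) <= 1].

(* [powR] is 0 at base 0 for nonzero exponents; this only affects the boundary
   of the cube, a Lebesgue-null set. *)
Definition jacobi_weight (n : nat) (n1 n2 beta : R)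
    (x : n.-tuple (measurableTypeR R)) : R :=
  (\prod_(i < n)
     ((tnth x i : R) `^ (beta / 2 * (n1 - n%:R + 1) - 1) *
      (1 - (tnth x i : R)) `^ (beta / 2 * (n2 - n%:R + 1) - 1))) *
  \prod_(i < n) \prod_(j < n | (i < j)%N)
     `|(tnth x i : R) - (tnth x j : R)| `^ beta.

Definition jacobi_Z (n : nat) (n1 n2 beta : R) : R :=
  fine (\int[tuple_lebesgue_measure n]_(x in @unit_cube n)
          (jacobi_weight n1 n2 beta x)%:E)%E.

Definition jacobi_ensemble (n : nat) (n1 n2 beta : R)
    (A : set (n.-tuple (measurableTypeR R))) : \bar R :=
  (\int[tuple_lebesgue_measure n]_(x in A `&` @unit_cube n)
     ((jacobi_Z n n1 n2 beta)^-1 * jacobi_weight n1 n2 beta x)%:E)%E.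

End jacobi_ensemble.

Definition cvg_in_probability (R : realType) (d : nat -> measure_display)
    (T : forall n, measurableType (d n)) (P : forall n, probability (T n) R)
    (Y : forall n, T n -> R) (c : R) : Prop :=
  forall eps : R, 0 < eps ->
    P n [set w | eps <= `|Y n w - c|] @[n --> \oo] --> 0%E.

Definition empirical_mean (R : realType) (f : R -> R) n
    (x : n.-tuple (measurableTypeR R)) : R :=
  n%:R^-1 * \sum_(i < n) f (tnth x i).

Section limit_density.
Context {R : realType}.
Implicit Types p q x : R.

Definition lambda_minus p q : R :=
  (Num.sqrt (p / (p + q) * (1 - 1 / (p + q))) -
   Num.sqrt (1 / (p + q) * (1 - p / (p + q)))) ^+ 2.

Definition lambda_plus p q : R :=
  (Num.sqrt (p / (p + q) * (1 - 1 / (p + q))) +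
   Num.sqrt (1 / (p + q) * (1 - p / (p + q)))) ^+ 2.

Definition limit_density p q x : R :=
  (p + q) / (2 * pi) *
  (Num.sqrt (- (x - lambda_minus p q) * (x - lambda_plus p q)) /
   (x * (1 - x))) *
  \1_(`[lambda_minus p q, lambda_plus p q]) x.

End limit_density.

(* Main.v *)
Require Import Defs.
From HB Require Import structures.
From mathcomp Require Import all_boot all_order all_algebra.
From mathcomp Require Import all_classical all_reals all_analysis.
From mathcomp Require Import measurable_realfun ring lra.

(** Law of large numbers for the beta-Jacobi ensemble, by a loop equation.

    Fix z > 1 and let G be the mean of 1 / (z - x) over the n particles. Move
    every particle by the map phi (x) = x + t x (1 - x) / (z - x), which
    preserves [0, 1]. The weight is a product of powers of x, 1 - x and
    |x - y|, so the logarithm of its growth is t times an explicit sum over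
    particles and pairs, up to an error of second order in t
    ([jacobi_weight_deform]). That sum is, up to terms of order n, equal to
    - (beta / 2) n T q (G) with T = n1 + n2 - n and q a quadratic polynomial,
    [loop_poly] ([log_weight_drift_loop]). On the event that q (G) is at least
    eps in absolute value, a suitable sign of a small fixed t makes the weight
    grow by a factor exponential in n T, while phi shrinks volumes by at most
    2 ^ n. Comparing with the total mass after a change of variables
    ([jacobi_ensemble_le]), one finds that the event has probability
    exponentially small in n ^ 2 ([loop_event_tail]).

    Hence G tends in probability to the root of the limiting quadratic
    ([stieltjes_cvg]). All three regimes fit one family of quadratics, with
    parameters the limits of n / T and (n1 - n) / T; the first regime is the
    second one with p = q = 1, and in the third one the quadratic degenerates to
    (z - lambda) G = 1.

    The functions f whose empirical means converge to their integral against the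
    limit law form a closed subspace. It contains all 1 / (z - x), hence, by
    letting z tend to infinity, all monomials ([concentrates_monomial]), hence
    all continuous functions, by Bernstein's theorem ([weierstrass]).

    It remains to identify the root of the quadratic with the Stieltjes
    transform of the stated density ([integral_bulk_stieltjes]); partial
    fractions give an antiderivative that is a sum of three arctangents
    ([atan_primitive]). *)

Set Implicit Arguments.
Unset Strict Implicit.
Unset Printing Implicit Defensive.

Import Order.TTheory GRing.Theory Num.Theory.
Import numFieldNormedType.Exports.

Local Open Scope classical_set_scope.
Local Open Scope ring_scope.

(** * Integrals under coordinatewise co-Lipschitz maps *)

Section coLipschitz_maps.
Context {R : realType}.
Local Notation leb := (@lebesgue_measure R).
Implicit Types (K : R) (phi : R -> R).

Definition coLipschitz K phi := forall x y, `|x - y| <= K * `|phi x - phi y|.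

(** The preimage need not be an interval, but its diameter is at most
    K (b - a). *)
Lemma coLipschitz_preimage_itv K phi (a b : R) : a <= b ->
  coLipschitz K phi -> measurable_fun setT phi ->
  (leb (phi @^-1` `]a, b]) <= (K * (b - a))%:E)%E.
Proof.
move=> ab cophi mphi.
have mpre : measurable (phi @^-1` `]a, b]).
  by rewrite -[X in measurable X]setTI; exact: mphi.
have K0 : 0 <= K.
  have := cophi 1 0; have := normr_ge0 (phi 1 - phi 0).
  by rewrite subr0 normr1; nra.
have [->|/set0P S0] := eqVneq (phi @^-1` `]a, b]) set0.
  by rewrite measure0 lee_fin mulr_ge0// subr_ge0.
have diam x y : (phi @^-1` `]a, b]) x -> (phi @^-1` `]a, b]) y ->
    x - y <= K * (b - a).
  rewrite /= !in_itv/= => /andP[ax xb] /andP[ay yb].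
  apply: le_trans (ler_norm _) _; apply: le_trans (cophi _ _) _.
  by apply: ler_wpM2l => //; rewrite ler_norml; lra.
set S := phi @^-1` `]a, b] in mpre S0 diam *.
have [s0 Ss0] := S0.
have lbS : has_lbound S.
  by exists (s0 - K * (b - a)) => y Sy; have := diam _ _ Ss0 Sy; lra.
apply: (@le_trans _ _ (leb `[inf S, inf S + K * (b - a)])).
  apply: le_measure; rewrite ?inE//.
  move=> x Sx /=; rewrite in_itv/=; apply/andP; split; first exact: ge_inf.
  rewrite -lerBlDr; apply: lb_le_inf => // y Sy.
  by have := diam _ _ Sx Sy; lra.
rewrite lebesgue_measure_itv/= lte_fin; case: ifPn => _.
  by rewrite -EFinB lee_fin; lra.
by rewrite lee_fin mulr_ge0// subr_ge0.
Qed.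

(** A cover of B by half-open intervals pulls back to a cover of the preimage
    by sets of diameter at most K times the original lengths. *)
Lemma coLipschitz_preimage K phi (B : set R) : 0 < K ->
  coLipschitz K phi -> measurable_fun setT phi ->
  measurable (B : set (measurableTypeR R)) ->
  (leb (phi @^-1` B) <= K%:E * leb B)%E.
Proof.
move=> K0 cophi mphi mB; rewrite -lee_pdivrMl//.
rewrite [X in (_ <= X)%E]/lebesgue_measure /lebesgue_stieltjes_measure/=.
rewrite /measure_extension /mu_ext/=.
apply: le_ereal_inf_tmp => _ [F [mF BF] <-]; rewrite lee_pdivrMl//.
have mpre k : measurable (phi @^-1` (F k)).
  rewrite -[X in measurable X]setTI; apply: mphi => //.
  by case: (mF k) => -[x y] _ <-; exact: measurable_itv.
have mpreB : measurable (phi @^-1` B) by rewrite -[X in measurable X]setTI; exact: mphi.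
apply: (@le_trans _ _ (\sum_(k <oo) leb (phi @^-1` (F k)))%E).
  apply: measure_sigma_subadditive => //.
  by rewrite -preimage_bigcup; exact: preimage_subset.
rewrite -nneseriesZl; last by move=> i _; exact: wlength_ge0.
apply: lee_nneseries => [i _ _|i _]; first exact: measure_ge0.
have /ocitvP[->|[[a b]/= ab ->]] := mF i.
  by rewrite preimage_set0 measure0 wlength0 mule0.
rewrite wlength_itv_bnd ?(ltW ab)//= -EFinM.
exact: coLipschitz_preimage_itv (ltW ab) cophi mphi.
Qed.

End coLipschitz_maps.

Section tuple_coLipschitz_maps.
Context {R : realType}.
Local Notation R' := (measurableTypeR R).
Local Notation tleb := (@tuple_lebesgue_measure R).
Implicit Types (K : R) (phi : R -> R).

Definition tuple_map phi n (x : n.-tuple R') : n.-tuple R' :=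
  [tuple of map phi x].

Lemma measurable_tuple_map phi n : measurable_fun setT (phi : R' -> R') ->
  measurable_fun setT (@tuple_map phi n).
Proof.
move=> mphi; apply/measurable_fun_tnthP => i.
rewrite (_ : _ \o _ = (phi : R' -> R') \o (fun x => tnth x i)).
  by apply: measurableT_comp => //; exact: measurable_tnth.
by apply/funext => x /=; rewrite tnth_map.
Qed.

Lemma ge0_integral_coLipschitz K phi (F : R' -> \bar R) : 0 < K ->
  coLipschitz K phi -> measurable_fun setT (phi : R' -> R') ->
  measurable_fun setT F -> (forall x, 0 <= F x)%E ->
  (\int[lebesgue_measure]_x F (phi x) <= K%:E * \int[lebesgue_measure]_x F x)%E.
Proof.
move=> K0 cophi mphi mF F0.
have -> : (\int[lebesgue_measure]_x F (phi x) =
    \int[pushforward lebesgue_measure (phi : R' -> R')]_x F x)%E.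
  by rewrite ge0_integral_pushforward.
pose k := NngNum (ltW K0).
rewrite -[leRHS]/((k%:num)%:E * _)%E -ge0_integral_mscale//.
apply: ge0_le_measure_integral => // S mS.
exact: coLipschitz_preimage.
Qed.

Lemma ge0_integral_tuple_cons n (F : n.+1.-tuple R' -> \bar R) :
  measurable_fun setT F -> (forall x, 0 <= F x)%E ->
  (\int[tleb n.+1]_x F x =
   \int[lebesgue_measure]_x \int[tleb n]_t F (tuple_cons (x, t)))%E.
Proof.
move=> mF F0; rewrite /= /lebesgue_cons ge0_integral_pushforward//; last first.
  exact: measurable_tuple_cons.
rewrite preimage_setT fubini_tonelli1//; last first.
  by move=> xt; exact: F0.
by apply: measurableT_comp => //; exact: measurable_tuple_cons.
Qed.

(** One coordinate at a time, by Tonelli's theorem: each costs a factor K. *)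
Lemma ge0_integral_tuple_map K phi n (F : n.-tuple R' -> \bar R) : 0 < K ->
  coLipschitz K phi -> measurable_fun setT (phi : R' -> R') ->
  measurable_fun setT F -> (forall x, 0 <= F x)%E ->
  (\int[tleb n]_x F (tuple_map phi x) <= (K ^+ n)%:E * \int[tleb n]_x F x)%E.
Proof.
move=> K0 cophi mphi; elim: n F => [|n IHn] F mF F0.
  rewrite expr0 mul1e (eq_integral F)// => x _.
  by rewrite [tuple_map _ _]tuple0 [x]tuple0.
have mFc : measurable_fun setT (F \o @tuple_cons R n).
  by apply: measurableT_comp => //; exact: measurable_tuple_cons.
have mFx x : measurable_fun setT (fun t => F (tuple_cons (x, t))).
  exact: (measurableT_comp mFc (measurable_pair1 _)).
have mI : measurable_fun setT (fun x => \int[tleb n]_t F (tuple_cons (x, t)))%E.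
  apply: (@measurable_fun_fubini_tonelli_F _ _ R' _ R (tleb n) _ mFc) => xt; exact: F0.
have I0 x : (0 <= \int[tleb n]_t F (tuple_cons (x, t)))%E.
  by apply: integral_ge0 => t _; exact: F0.
have mG : measurable_fun setT
    (fun xt : R' * n.-tuple R' => F (tuple_map phi (tuple_cons xt))).
  apply: measurableT_comp => //; apply: measurableT_comp.
    exact: measurable_tuple_map.
  exact: measurable_tuple_cons.
rewrite !ge0_integral_tuple_cons//; last first.
  by apply: measurableT_comp => //; exact: measurable_tuple_map.
apply: (@le_trans _ _ (\int[lebesgue_measure]_x ((K ^+ n)%:E *
    \int[tleb n]_t F (tuple_cons (phi x, t))))%E).
  apply: ge0_le_integral => //.
  - by move=> x _; apply: integral_ge0.
  - apply: (@measurable_fun_fubini_tonelli_F _ _ R' _ R (tleb n) _ mG) => xt.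
    exact: F0.
  - by apply: measurable_funeM; exact: (measurableT_comp mI mphi).
  move=> x _; apply: le_trans (IHn _ (mFx (phi x)) _) => //.
  rewrite (eq_integral (fun t => F (tuple_cons (phi x, tuple_map phi t))))//.
  by move=> t _; congr F; exact: val_inj.
rewrite ge0_integralZl//; last 2 first.
  exact: (measurableT_comp mI mphi).
  by rewrite lee_fin exprn_ge0// ltW.
rewrite exprSr EFinM -muleA; apply: lee_wpmul2l.
  by rewrite lee_fin exprn_ge0// ltW.
exact: (ge0_integral_coLipschitz K0 cophi mphi mI I0).
Qed.

End tuple_coLipschitz_maps.

(** * Ensemble probabilities under co-Lipschitz maps *)

Section jacobi_coLipschitz_maps.
Context {R : realType}.
Local Notation R' := (measurableTypeR R).
Local Notation tleb := (@tuple_lebesgue_measure R).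

Lemma measurable_tnthR n (i : 'I_n) :
  measurable_fun setT (fun x : n.-tuple R' => tnth x i : R).
Proof. exact: (@measurable_tnth _ R' n i). Qed.

Lemma measurable_unit_cube n : measurable (@unit_cube R n).
Proof.
have -> : @unit_cube R n = \bigcap_(i in [set: 'I_n])
    ((fun x : n.-tuple R' => tnth x i : R) @^-1` `[0, 1]).
  apply/seteqP; split=> [x h i _|x h i]; first by rewrite /= in_itv/= h.
  by have := h i I; rewrite /= in_itv.
apply: fin_bigcap_measurable => // i _.
by rewrite -[X in measurable X]setTI; apply: measurable_tnthR.
Qed.

Lemma measurable_jacobi_weight n (n1 n2 beta : R) :
  measurable_fun setT (@jacobi_weight R n n1 n2 beta).
Proof.
apply: measurable_funM.
  apply: measurable_prod => /= i _; apply: measurable_funM.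
    exact: (measurableT_comp (measurable_powR _) (measurable_tnthR i)).
  apply: (measurableT_comp (measurable_powR _)).
  by apply: measurable_funB => //; exact: measurable_tnthR.
apply: measurable_prod => /= i _; under eq_fun do rewrite big_mkcond/=.
apply: measurable_prod => /= j _; case: (i < j)%N => //.
apply: (measurableT_comp (measurable_powR _)).
apply: measurableT_comp => //.
by apply: measurable_funB; exact: measurable_tnthR.
Qed.

Lemma jacobi_weight_ge0 n (n1 n2 beta : R) (x : n.-tuple R') :
  0 <= jacobi_weight n1 n2 beta x.
Proof.
apply: mulr_ge0; last by do 2!apply: prodr_ge0 => ? _; exact: powR_ge0.
by apply: prodr_ge0 => i _; rewrite mulr_ge0// powR_ge0.
Qed.

(** Substituting a map under which the weight grows by the factor c turns the
    mass of A into at most K ^ n / c of the total mass. *)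
Lemma jacobi_ensemble_le n (n1 n2 beta K c : R) (phi : R -> R)
    (A : set (n.-tuple R')) : 0 < K -> 0 < c -> coLipschitz K phi ->
  measurable_fun setT (phi : R' -> R') -> measurable A ->
  (forall x, A x -> unit_cube x -> unit_cube (tuple_map phi x) /\
     c * jacobi_weight n1 n2 beta x
       <= jacobi_weight n1 n2 beta (tuple_map phi x)) ->
  (jacobi_ensemble n1 n2 beta A <= (K ^+ n / c)%:E)%E.
Proof.
move=> K0 c0 cophi mphi mA Aphi; rewrite /jacobi_ensemble.
set Z := jacobi_Z _ _ _ _; set w := jacobi_weight n1 n2 beta.
have Z0 : 0 <= Z.
  by apply: fine_ge0; apply: integral_ge0 => x _; rewrite lee_fin jacobi_weight_ge0.
have mcube := @measurable_unit_cube n.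
have mw : measurable_fun setT (fun x : n.-tuple R' => (Z^-1 * w x)%:E).
  by apply/measurable_EFinP; apply: measurable_funM => //; exact: measurable_jacobi_weight.
have w0 x : 0 <= Z^-1 * w x by rewrite mulr_ge0 ?invr_ge0// jacobi_weight_ge0.
pose F := ((fun x => (Z^-1 * w x)%:E) \_ (@unit_cube R n))%E.
have F0 x : (0 <= F x)%E by rewrite /F patchE; case: ifP => // _; rewrite lee_fin.
have mF : measurable_fun setT F.
  by apply/(measurable_restrictT _ mcube); exact: measurable_funTS.
have mFphi : measurable_fun setT (fun x => F (tuple_map phi x)).
  by apply: measurableT_comp => //; exact: measurable_tuple_map.
have intF : (\int[tleb n]_x F x <= 1)%E.
  rewrite -integral_mkcond; under eq_integral do rewrite EFinM.
  rewrite ge0_integralZl//; last 3 first.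
    by apply/measurable_EFinP; apply: measurable_funTS; exact: measurable_jacobi_weight.
    by move=> x _; rewrite lee_fin jacobi_weight_ge0.
    by rewrite lee_fin invr_ge0.
  have : (0 <= \int[tleb n]_(x in unit_cube (n:=n)) (w x)%:E)%E.
    by apply: integral_ge0 => x _; rewrite lee_fin jacobi_weight_ge0.
  rewrite /Z /jacobi_Z -/w.
  case: integral => [r| |] //=; last by rewrite invr0 mul0e.
  by move=> _; rewrite -EFinM lee_fin; have [->|r0] := eqVneq r 0; rewrite ?mulr0// mulVf.
rewrite integral_mkcond.
apply: (@le_trans _ _ (\int[tleb n]_x (c^-1%:E * F (tuple_map phi x)))%E).
  apply: ge0_le_integral => //.
  - by move=> x _; rewrite patchE; case: ifP => // _; rewrite lee_fin.
  - apply/(measurable_restrictT _ (measurableI _ _ mA mcube)).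
    exact: measurable_funTS.
  - exact: measurable_funeM.
  move=> x _; rewrite patchE; case: ifPn => [|_]; last first.
    by rewrite mule_ge0// lee_fin invr_ge0 ltW.
  rewrite inE => -[Ax cx]; have [cpx wpx] := Aphi _ Ax cx.
  rewrite /F patchE mem_set//= -EFinM lee_fin [leRHS]mulrCA.
  by apply: ler_wpM2l; rewrite ?invr_ge0// ler_pdivlMl.
rewrite ge0_integralZl//; last by rewrite lee_fin invr_ge0 ltW.
rewrite mulrC EFinM; apply: lee_wpmul2l; first by rewrite lee_fin invr_ge0 ltW.
apply: (le_trans (ge0_integral_tuple_map K0 cophi mphi mF F0)).
rewrite -[leRHS]mule1; apply: lee_wpmul2l => //.
by rewrite lee_fin exprn_ge0// ltW.
Qed.

End jacobi_coLipschitz_maps.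

(** * The deformation of the unit interval *)

Section deformation.
Context {R : realType}.
Local Notation R' := (measurableTypeR R).
Implicit Types z t x y v a : R.

Definition clamp01 x : R := Num.max 0 (Num.min 1 x).

(** The vector field x (1 - x) / (z - x) vanishes at both ends of the unit
    interval, so the deformation moves points inside it and is the identity
    elsewhere; [clamp01] makes it total. *)
Definition deform z t x : R :=
  x + t * (clamp01 x * (1 - clamp01 x) / (z - clamp01 x)).

(** Bound for the logarithmic derivatives of the deformation in t. *)
Definition deform_rate z : R := z / (z - 1).

Lemma clamp01_itv x : 0 <= clamp01 x <= 1.
Proof. by rewrite /clamp01 le_max lexx/= ge_max ler01 ge_min lexx. Qed.

Lemma clamp01_id x : 0 <= x <= 1 -> clamp01 x = x.
Proof. by move=> /andP[x0 x1]; rewrite /clamp01 (min_idPr x1) (max_idPr x0). Qed.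

Lemma clamp01_lipschitz x y : `|clamp01 x - clamp01 y| <= `|x - y|.
Proof.
wlog xy : x y / x <= y.
  move=> H; have [|/ltW] := leP x y; first exact: H.
  by rewrite (distrC (clamp01 x)) (distrC x); exact: H.
rewrite (distrC (clamp01 x)) (distrC x) (@ger0_norm _ (y - x)) ?subr_ge0//.
rewrite /clamp01 /Num.max /Num.min ler_norml.
by repeat case: ifPn; rewrite -?leNgt; lra.
Qed.

Lemma deform_rate_ge1 z : 1 < z -> 1 <= deform_rate z.
Proof. by move=> z1; rewrite /deform_rate ler_pdivlMr; lra. Qed.

(** The three factorizations below make every factor of the weight, evaluated at
    the deformed point, equal to its old value times 1 + t v, with v bounded by
    [deform_rate z]; the one for differences rests on the divided difference
    of the vector field. *)
Lemma deform_left z t x : 0 <= x <= 1 ->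
  deform z t x = x * (1 + t * ((1 - x) / (z - x))).
Proof. by move=> x01; rewrite /deform clamp01_id//; ring. Qed.

Lemma deform_right z t x : 1 < z -> 0 <= x <= 1 ->
  1 - deform z t x = (1 - x) * (1 + t * - (x / (z - x))).
Proof. by move=> z1 x01; rewrite /deform clamp01_id//; ring. Qed.

Lemma deform_diff z t x y : 1 < z -> 0 <= x <= 1 -> 0 <= y <= 1 ->
  deform z t x - deform z t y =
  (x - y) * (1 + t * (1 - z * (z - 1) * ((z - x)^-1 * (z - y)^-1))).
Proof.
move=> z1 x01 y01; rewrite /deform !clamp01_id//.
by field; apply/andP; split; lra.
Qed.

Lemma left_rate z x : 1 < z -> 0 <= x <= 1 ->
  `|(1 - x) / (z - x)| <= deform_rate z.
Proof.
move=> z1 /andP[x0 x1]; apply: le_trans (deform_rate_ge1 z1).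
by rewrite ger0_norm ?divr_ge0 ?ler_pdivrMr; lra.
Qed.

Lemma inv_itv z x : 1 < z -> 0 <= x <= 1 -> z^-1 <= (z - x)^-1 <= (z - 1)^-1.
Proof.
move=> z1 /andP[x0 x1].
by rewrite !lef_pV2 ?posrE; lra.
Qed.

Lemma right_rate z x : 1 < z -> 0 <= x <= 1 ->
  `|- (x / (z - x))| <= deform_rate z.
Proof.
move=> z1 x01; have /andP[x0 x1] := x01.
have /andP[u0 u1] := inv_itv z1 x01.
have z0 : 0 < z^-1 by rewrite invr_gt0; lra.
rewrite normrN ger0_norm; last by rewrite mulr_ge0//; lra.
by apply: ler_pM => //; lra.
Qed.

Lemma diff_rate z x y : 1 < z -> 0 <= x <= 1 -> 0 <= y <= 1 ->
  `|1 - z * (z - 1) * ((z - x)^-1 * (z - y)^-1)| <= deform_rate z.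
Proof.
move=> z1 /(inv_itv z1) /andP[x0 x1] /(inv_itv z1) /andP[y0 y1].
have z0 : 0 < z^-1 by rewrite invr_gt0; lra.
have zz : 0 < z * (z - 1) by apply: mulr_gt0; lra.
set u := (z - x)^-1 in x0 x1 *; set v := (z - y)^-1 in y0 y1 *.
have uv0 : 0 <= u * v by apply: mulr_ge0; lra.
have uv1 : u * v <= (z - 1)^-1 * (z - 1)^-1 by apply: ler_pM; lra.
have r : z * (z - 1) * ((z - 1)^-1 * (z - 1)^-1) = deform_rate z.
  by rewrite /deform_rate; field; lra.
have := deform_rate_ge1 z1; rewrite -r ler_norml => r1.
have := ler_wpM2l (ltW zz) uv1; have := mulr_ge0 (ltW zz) uv0.
by set p := z * (z - 1) * (u * v) => p0 p1; apply/andP; split; lra.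
Qed.

Lemma deform_factor_le z t v : 1 < z -> `|t| * deform_rate z <= 2^-1 ->
  `|v| <= deform_rate z -> `|t * v| <= 2^-1.
Proof.
move=> z1 tz vz; rewrite normrM; apply: le_trans tz.
exact: ler_wpM2l.
Qed.

Lemma deform_itv z t x : 1 < z -> `|t| * deform_rate z <= 2^-1 ->
  0 <= x <= 1 -> 0 <= deform z t x <= 1.
Proof.
move=> z1 tz x01; have /andP[x0 x1] := x01.
have := deform_factor_le z1 tz (left_rate z1 x01).
have := deform_factor_le z1 tz (right_rate z1 x01).
rewrite !ler_norml => /andP[l1 _] /andP[l2 _].
apply/andP; split; first by rewrite deform_left// mulr_ge0//; lra.
by rewrite -subr_ge0 deform_right// mulr_ge0//; lra.
Qed.

(** The perturbation t x (1 - x) / (z - x) is 1/2-Lipschitz, so the deformation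
    contracts distances by at most a factor 2. *)
Lemma deform_coLipschitz z t : 1 < z -> `|t| * deform_rate z <= 2^-1 ->
  coLipschitz 2 (deform z t).
Proof.
move=> z1 tz x y.
set g := fun c => c * (1 - c) / (z - c).
have gE : g (clamp01 x) - g (clamp01 y) = (clamp01 x - clamp01 y) *
    (1 - z * (z - 1) * ((z - clamp01 x)^-1 * (z - clamp01 y)^-1)).
  have := clamp01_itv x; have := clamp01_itv y => /andP[_ ?] /andP[_ ?].
  by rewrite /g; field; apply/andP; split; lra.
have glip : `|t * (g (clamp01 x) - g (clamp01 y))| <= 2^-1 * `|x - y|.
  rewrite gE mulrCA normrM mulrC; apply: ler_pM => //.
    exact: deform_factor_le (diff_rate z1 (clamp01_itv x) (clamp01_itv y)).
  exact: clamp01_lipschitz.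
rewrite /deform -/(g (clamp01 x)) -/(g (clamp01 y)).
have -> : x + t * g (clamp01 x) - (y + t * g (clamp01 y)) =
  (x - y) - - (t * (g (clamp01 x) - g (clamp01 y))) by ring.
by have := lerB_dist (x - y) (- (t * (g (clamp01 x) - g (clamp01 y)))); rewrite normrN; lra.
Qed.

Lemma continuous_clamp01 : continuous clamp01.
Proof.
move=> x; apply: continuous_max; first exact: cst_continuous.
by apply: continuous_min => //; exact: cst_continuous.
Qed.

Lemma measurable_deform z t : 1 < z ->
  measurable_fun setT (deform z t : R' -> R').
Proof.
move=> z1; apply: continuous_measurable_fun => x.
have cclamp01 := @continuous_clamp01 x.
apply: cvgD; first exact: cvg_id.
apply: cvgM; first exact: cvg_cst.
apply: cvgM; first apply: cvgM; first exact: cclamp01.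
  by apply: cvgB; [exact: cvg_cst|exact: cclamp01].
apply: cvgV; first by have := clamp01_itv x; lra.
by apply: cvgB; [exact: cvg_cst|exact: cclamp01].
Qed.

(** Second-order lower bound for logarithms of factors close to 1: from
    exp (2 v ^ 2 - v) >= 1 - v + 2 v ^ 2 and
    (1 + v) (1 - v + 2 v ^ 2) = 1 + v ^ 2 (1 + 2 v) >= 1. *)
Lemma ln1D_ge v : `|v| <= 2^-1 -> v - 2 * v ^+ 2 <= ln (1 + v).
Proof.
rewrite ler_norml => /andP[v1 v2].
have v0 : 0 < 1 + v by lra.
rewrite -ler_expR lnK ?posrE//.
have := expR_ge1Dx (- (v - 2 * v ^+ 2)) => e.
rewrite -[expR (v - _)]invrK -expRN -[leRHS]invrK lef_pV2 ?posrE ?invr_gt0 ?expR_gt0//.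
apply: le_trans e; rewrite -[(1 + v)^-1]mul1r ler_pdivrMr//.
by have := sqr_ge0 v; rewrite expr2; nra.
Qed.

Lemma powR1D_ge a v : `|v| <= 2^-1 ->
  expR (a * v - 2 * `|a| * v ^+ 2) <= (1 + v) `^ a.
Proof.
move=> v12; have := v12; rewrite ler_norml => /andP[v1 v2].
have v0 : 1 + v != 0 by lra.
rewrite /powR (negPf v0) ler_expR.
have l1 := ln1D_ge v12.
have l2 : ln (1 + v) <= v by apply: le_ln1Dx; lra.
have := sqr_ge0 v.
by have [a0|a0] := leP 0 a; [rewrite ger0_norm//|rewrite ltr0_norm//]; nra.
Qed.

End deformation.

(** * Growth of the weight under the deformation *)

Section weight_growth.
Context {R : realType}.
Local Notation R' := (measurableTypeR R).
Implicit Types z t beta a b : R.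

(** First variation at t = 0 of the logarithm of the weight with exponents a, b
    and beta, when every coordinate is moved by [deform z t]. *)
Definition log_weight_drift z a b beta n (x : n.-tuple R') : R :=
  \sum_(i < n) (a * ((1 - tnth x i) / (z - tnth x i)) +
                b * - (tnth x i / (z - tnth x i))) +
  \sum_(i < n) \sum_(j < n | (i < j)%N)
    beta * (1 - z * (z - 1) * ((z - tnth x i)^-1 * (z - tnth x j)^-1)).

Lemma powR_growth z t a (u v v' : R) : 1 < z -> `|t| * deform_rate z <= 2^-1 ->
  `|v| <= deform_rate z -> 0 <= u -> v' = u * (1 + t * v) ->
  u `^ a * expR (t * (a * v) - 2 * t ^+ 2 * deform_rate z ^+ 2 * `|a|)
    <= v' `^ a.
Proof.
move=> z1 tz vz u0 ->.
have tv := deform_factor_le z1 tz vz.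
have := tv; rewrite ler_norml => /andP[tv1 tv2].
rewrite powRM//; last by lra.
apply: ler_wpM2l; first exact: powR_ge0.
apply: le_trans (powR1D_ge a tv); rewrite ler_expR.
have vv : v ^+ 2 <= deform_rate z ^+ 2.
  by rewrite -[v ^+ 2]real_normK ?num_real// lerXn2r ?nnegrE// (le_trans _ vz).
have tvv : (t * v) ^+ 2 <= t ^+ 2 * deform_rate z ^+ 2.
  by rewrite exprMn; apply: ler_wpM2l => //; exact: sqr_ge0.
by have := ler_wpM2l (normr_ge0 a) tvv; lra.
Qed.

(** The weight is a product of powers, and [powR_growth] applies to each factor.
    The n singletons contribute a and b, the fewer than n ^ 2 pairs contribute
    beta to the second-order error. *)
Lemma jacobi_weight_deform z t n (n1 n2 beta a b : R) (x : n.-tuple R') :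
  1 < z -> `|t| * deform_rate z <= 2^-1 -> 0 < beta -> unit_cube x ->
  a = beta / 2 * (n1 - n%:R + 1) - 1 ->
  b = beta / 2 * (n2 - n%:R + 1) - 1 ->
  expR (t * log_weight_drift z a b beta x -
        2 * t ^+ 2 * deform_rate z ^+ 2 *
        (n%:R * (`|a| + `|b|) + n%:R ^+ 2 * beta)) * jacobi_weight n1 n2 beta x
  <= jacobi_weight n1 n2 beta (tuple_map (deform z t) x).
Proof.
move=> z1 tz beta0 x01 aE bE.
set L := 2 * t ^+ 2 * deform_rate z ^+ 2.
have L0 : 0 <= L by rewrite mulr_ge0 ?sqr_ge0// mulr_ge0 ?sqr_ge0.
pose e i := t * (a * ((1 - tnth x i) / (z - tnth x i)) +
                b * - (tnth x i / (z - tnth x i))) - L * (`|a| + `|b|).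
pose e2 i j := t * (beta * (1 - z * (z - 1) *
   ((z - tnth x i)^-1 * (z - tnth x j)^-1))) - L * beta.
apply: (@le_trans _ _ (expR (\sum_(i < n) e i +
    \sum_(i < n) \sum_(j < n | (i < j)%N) e2 i j) * jacobi_weight n1 n2 beta x)).
  apply: ler_wpM2r; first exact: jacobi_weight_ge0.
  rewrite ler_expR /log_weight_drift /e sumrB -mulr_sumr sumr_const card_ord.
  rewrite -(mulr_natl (L * _)).
  have -> : \sum_(i < n) \sum_(j < n | (i < j)%N) e2 i j =
    t * (\sum_(i < n) \sum_(j < n | (i < j)%N)
      beta * (1 - z * (z - 1) * ((z - tnth x i)^-1 * (z - tnth x j)^-1))) -
    \sum_(i < n) \sum_(j < n | (i < j)%N) L * beta.
    rewrite mulr_sumr -sumrB; apply: eq_bigr => i _.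
    by rewrite mulr_sumr -sumrB; apply: eq_bigr.
  have : \sum_(i < n) \sum_(j < n | (i < j)%N) L * beta <= n%:R ^+ 2 * (L * beta).
    rewrite expr2 -mulrA mulr_natl -[X in _ *+ X]card_ord -sumr_const.
    apply: ler_sum => i _; rewrite mulr_natl -[X in _ *+ X]card_ord -sumr_const.
    rewrite [leRHS](bigID (fun j : 'I_n => (i < j)%N))/= lerDl.
    by apply: sumr_ge0 => j _; rewrite mulr_ge0// ltW.
  set A := \sum_(i < n) \sum_(j < n | _) L * beta.
  by lra.
rewrite expRD !expR_sum /jacobi_weight -aE -bE mulrACA.
under [X in _ * (X * _) <= _]eq_bigr do rewrite expR_sum.
rewrite -[X in X * _ <= _]big_split -[X in _ * X <= _]big_split/=.
apply: ler_pM.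
- apply: prodr_ge0 => i _; rewrite !mulr_ge0 ?expR_ge0 ?powR_ge0//.
- apply: prodr_ge0 => i _; by rewrite mulr_ge0 ?prodr_ge0// => j _;
    rewrite ?expR_ge0 ?powR_ge0.
- apply: ler_prod => i _; rewrite tnth_map; apply/andP; split.
    by rewrite !mulr_ge0 ?expR_ge0 ?powR_ge0.
  have xi := x01 i; have /andP[xi0 xi1] := xi.
  have -> : e i = (t * (a * ((1 - tnth x i) / (z - tnth x i))) - L * `|a|) +
    (t * (b * - (tnth x i / (z - tnth x i))) - L * `|b|) by rewrite /e; ring.
  rewrite expRD mulrC mulrACA; apply: ler_pM.
  + by rewrite mulr_ge0 ?expR_ge0 ?powR_ge0.
  + by rewrite mulr_ge0 ?expR_ge0 ?powR_ge0.
  + exact: powR_growth z1 tz (left_rate z1 xi) _ (deform_left _ _ xi).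
  + apply: powR_growth z1 tz (right_rate z1 xi) _ (deform_right _ z1 xi).
    by rewrite subr_ge0.
- apply: ler_prod => i _; rewrite -big_split/=; apply/andP; split.
    by apply: prodr_ge0 => j _; rewrite mulr_ge0 ?expR_ge0 ?powR_ge0.
  apply: ler_prod => j _; rewrite !tnth_map; apply/andP; split.
    by rewrite mulr_ge0 ?expR_ge0 ?powR_ge0.
  rewrite mulrC /e2 -{3}(ger0_norm (ltW beta0)).
  have v := diff_rate z1 (x01 i) (x01 j).
  have dE : `|deform z t (tnth x i) - deform z t (tnth x j)| =
      `|(tnth x i : R) - tnth x j| *
      (1 + t * (1 - z * (z - 1) * ((z - tnth x i)^-1 * (z - tnth x j)^-1))).
    rewrite deform_diff// normrM; congr (_ * _); rewrite ger0_norm//.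
    by have := deform_factor_le z1 tz v; rewrite ler_norml => /andP[]; lra.
  exact: (powR_growth _ z1 tz v (normr_ge0 _) dE).
Qed.

End weight_growth.

(** * The loop equation *)

Section loop_equation.
Context {R : realType}.
Local Notation R' := (measurableTypeR R).
Implicit Types z t beta a b G al ga : R.

Definition stieltjes_mean z n (x : n.-tuple R') : R :=
  empirical_mean (fun y => (z - y)^-1) x.

(** The left-hand side of the quadratic (loop) equation satisfied in the limit
    by the Stieltjes transform at z. With al and ga the limits of n / T and
    (n1 - n) / T, where T = n1 + n2 - n, the case al = 0 covers fast growing
    parameters. *)
Definition loop_poly z al ga G : R :=
  al * (z * (z - 1)) * G ^+ 2 + ((1 - al) * z - ga) * G - 1.

Lemma sum_ltn_mul n (u : 'I_n -> R) :
  \sum_(i < n) \sum_(j < n | (i < j)%N) u i * u j =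
  2^-1 * ((\sum_(i < n) u i) ^+ 2 - \sum_(i < n) u i ^+ 2).
Proof.
set A := LHS.
have A' : \sum_(i < n) \sum_(j < n | (j < i)%N) u i * u j = A.
  rewrite (exchange_big_dep xpredT)//=; apply: eq_bigr => i _.
  by apply: eq_bigr => j _; rewrite mulrC.
have -> : (\sum_(i < n) u i) ^+ 2 = A + A + \sum_(i < n) u i ^+ 2.
  rewrite expr2 big_distrlr/= -{2}A' /A -!big_split/=; apply: eq_bigr => i _.
  rewrite (bigID (fun j : 'I_n => (i < j)%N))/= -addrA; congr (_ + _).
  rewrite (bigD1 i)/= ?ltnn// addrC expr2; congr (_ + _).
  apply: eq_bigl => j; rewrite -leqNgt ltn_neqAle andbC.
  by congr (_ && _); rewrite -val_eqE.
by field.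
Qed.

Lemma stieltjes_meanE z n (x : n.-tuple R') : (0 < n)%N ->
  n%:R * stieltjes_mean z x = \sum_(i < n) (z - tnth x i)^-1.
Proof.
move=> n0; rewrite /stieltjes_mean /empirical_mean mulrA divff ?mul1r//.
by rewrite pnatr_eq0 -lt0n.
Qed.

Lemma stieltjes_mean_itv z n (x : n.-tuple R') : (0 < n)%N -> 1 < z ->
  unit_cube x -> z^-1 <= stieltjes_mean z x <= (z - 1)^-1.
Proof.
move=> n0 z1 x01; have n0' : (0 : R) < n%:R by rewrite ltr0n.
rewrite -(ler_pM2l n0' z^-1) -(ler_pM2l n0' _ (z - 1)^-1) stieltjes_meanE//.
have cst (c : R) : n%:R * c = \sum_(i < n) c.
  by rewrite sumr_const card_ord mulr_natl.
by rewrite !cst; apply/andP; split; apply: ler_sum => i _;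
  have /andP[] := inv_itv z1 (x01 i).
Qed.

(** The drift is the sum over particles and pairs of the first variation; up to
    diagonal terms of order n it is a quadratic polynomial in the Stieltjes
    transform of the empirical measure. *)
Lemma log_weight_drift_loop z n (n1 n2 beta a b T : R) (x : n.-tuple R') :
  (0 < n)%N -> 1 < z -> 0 < beta -> unit_cube x ->
  a = beta / 2 * (n1 - n%:R + 1) - 1 ->
  b = beta / 2 * (n2 - n%:R + 1) - 1 ->
  T = n1 + n2 - n%:R -> 0 < T ->
  `|log_weight_drift z a b beta x + beta / 2 * n%:R * T *
    loop_poly z (n%:R / T) ((n1 - n%:R) / T) (stieltjes_mean z x)|
  <= n%:R * (2 * (beta + 1) * deform_rate z).
Proof.
move=> n0 z1 beta0 x01 aE bE TE T0.
have n0' : (0 : R) < n%:R by rewrite ltr0n.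
have C1 := deform_rate_ge1 z1.
set C := deform_rate z in C1 *.
pose u i := (z - tnth x i)^-1.
set U := n%:R * stieltjes_mean z x.
have UE : U = \sum_(i < n) u i by rewrite /U stieltjes_meanE.
set V := \sum_(i < n) u i ^+ 2.
have sumn (c : R) : \sum_(i < n) c = n%:R * c.
  by rewrite sumr_const card_ord mulr_natl.
have xlt i : z - tnth x i != 0 by have /andP[_] := x01 i; lra.
have -> : log_weight_drift z a b beta x =
    a * (n%:R - (z - 1) * U) + b * (n%:R - z * U) +
    beta * (2^-1 * (n%:R ^+ 2 - n%:R) - z * (z - 1) * (2^-1 * (U ^+ 2 - V))).
  rewrite /log_weight_drift; congr (_ + _).
    rewrite big_split/= -!mulr_sumr.
    congr (_ * _ + _ * _).
      rewrite UE -[n%:R]mulr1 -sumn mulr_sumr -sumrB; apply: eq_bigr => i _.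
      by rewrite /u; field; exact: xlt.
    rewrite UE -[n%:R]mulr1 -sumn mulr_sumr -sumrB; apply: eq_bigr => i _.
    by rewrite /u; field; exact: xlt.
  under eq_bigr do rewrite -mulr_sumr sumrB -mulr_sumr.
  rewrite -mulr_sumr sumrB -mulr_sumr (sum_ltn_mul u) -UE -/V.
  congr (_ * (_ - _)).
  have := sum_ltn_mul (fun _ : 'I_n => 1).
  under eq_bigr do under eq_bigr do rewrite mulr1.
  by move=> ->; rewrite expr1n !sumn mulr1.
have -> : beta / 2 * n%:R * T *
    loop_poly z (n%:R / T) ((n1 - n%:R) / T) (stieltjes_mean z x) =
    beta / 2 * (z * (z - 1) * U ^+ 2 + ((T - n%:R) * z - (n1 - n%:R)) * U -
      n%:R * T).
  by rewrite /loop_poly /U; field; lra.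
have -> : a * (n%:R - (z - 1) * U) + b * (n%:R - z * U) +
    beta * (2^-1 * (n%:R ^+ 2 - n%:R) - z * (z - 1) * (2^-1 * (U ^+ 2 - V))) +
    beta / 2 * (z * (z - 1) * U ^+ 2 + ((T - n%:R) * z - (n1 - n%:R)) * U -
      n%:R * T) =
  (beta / 2 - 1) * ((n%:R - (z - 1) * U) - (z * U - n%:R)) - beta * n%:R / 2 +
  beta / 2 * (z * (z - 1) * V).
  by rewrite aE bE TE; field.
have /andP[G0 G1] := stieltjes_mean_itv n0 z1 x01.
have U0 : 0 <= z * U - n%:R.
  have zG : 1 <= z * stieltjes_mean z x.
    have z0 : 0 < z by lra.
    by have := ler_wpM2l (ltW z0) G0; rewrite mulfV ?gt_eqF.
  rewrite (_ : _ - _ = n%:R * (z * stieltjes_mean z x - 1)); last by rewrite /U; ring.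
  by rewrite mulr_ge0// subr_ge0.
have U1 : 0 <= n%:R - (z - 1) * U.
  have zG : (z - 1) * stieltjes_mean z x <= 1.
    have z0 : 0 < z - 1 by lra.
    by have := ler_wpM2l (ltW z0) G1; rewrite mulfV ?gt_eqF.
  rewrite (_ : _ - _ = n%:R * (1 - (z - 1) * stieltjes_mean z x)); last by rewrite /U; ring.
  by rewrite mulr_ge0// subr_ge0.
have V0 : 0 <= V by apply: sumr_ge0 => i _; exact: sqr_ge0.
have V1 : z * (z - 1) * V <= n%:R * C.
  have zz : 0 < z * (z - 1) by apply: mulr_gt0; lra.
  rewrite /V mulr_sumr -sumn; apply: ler_sum => i _.
  have -> : C = z * (z - 1) * ((z - 1)^-1 ^+ 2).
    by rewrite /C /deform_rate; field; lra.
  apply: ler_wpM2l; first exact: ltW.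
  have /andP[u0 u1] := inv_itv z1 (x01 i).
  rewrite lerXn2r ?nnegrE//; last by rewrite invr_ge0; lra.
  by apply: le_trans u0; rewrite invr_ge0; lra.
have V2 : 0 <= z * (z - 1) * V by rewrite !mulr_ge0//; lra.
have U2 : z * U - n%:R <= n%:R * C.
  have -> : n%:R * C = n%:R + n%:R * (z - 1)^-1.
    by rewrite /C /deform_rate; field; lra.
  have := ler_wpM2l (ltW n0') G1; rewrite -/U.
  by move: U1; lra.
have U3 : n%:R - (z - 1) * U <= n%:R by rewrite gerBl mulr_ge0 ?subr_ge0//; lra.
have nC : n%:R <= n%:R * C by rewrite ler_peMr// ltW.
move: U0 U1 U2 U3 V1 V2; set p := z * U - n%:R; set q := n%:R - (z - 1) * U.
set r := z * (z - 1) * V; set m := n%:R * C in nC *.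
move=> p0 q0 p1 q1 r1 r0.
have -> : n%:R * (2 * (beta + 1) * C) = 2 * (beta + 1) * m by rewrite /m; ring.
have b1 : `|(beta / 2 - 1) * (q - p)| <= (beta / 2 + 1) * m.
  rewrite normrM; apply: ler_pM => //; rewrite ler_norml; lra.
move: b1; rewrite !ler_norml => /andP[b1 b2].
have br0 : 0 <= beta / 2 * r by apply: mulr_ge0; lra.
have br1 : beta / 2 * r <= beta / 2 * m by apply: ler_wpM2l; lra.
have bn1 : beta / 2 * n%:R <= beta / 2 * m by apply: ler_wpM2l; lra.
have bn0 : 0 <= beta / 2 * n%:R by apply: mulr_ge0; lra.
apply/andP; split; lra.
Qed.

End loop_equation.

(** * Exponential concentration of the loop equation *)

Section concentration.
Context {R : realType}.
Local Notation R' := (measurableTypeR R).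
Implicit Types z t beta eps sg : R.

Lemma continuous_comp_clamp01 (f : R -> R) : {within `[0, 1], continuous f} ->
  continuous (f \o clamp01).
Proof.
move=> cf x; have /subspace_continuousP/(_ (clamp01 x)) := cf.
rewrite /= in_itv/= clamp01_itv => /(_ isT)/cvgrPdist_lt cfx.
apply/cvgrPdist_lt => e e0; have := cfx e e0; rewrite /within/= => H.
have Hx := @continuous_clamp01 R x _ H; near=> y.
have : `[0, 1]%classic (clamp01 y) -> `|f (clamp01 x) - f (clamp01 y)| < e.
  by near: y; exact: Hx.
by rewrite /= in_itv/= clamp01_itv; exact.
Unshelve. all: by end_near. Qed.

Lemma measurable_empirical_mean (f : R -> R) n : continuous f ->
  measurable_fun setT (fun x : n.-tuple R' => empirical_mean f x).
Proof.
move=> cf; apply: measurable_funM => //; apply: measurable_sum => i.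
have mf : measurable_fun setT f by exact: continuous_measurable_fun.
exact: (measurableT_comp mf (measurable_tnthR i)).
Qed.

Lemma continuous_inv_clamp01 z : 1 < z ->
  continuous (fun y : R => (z - clamp01 y)^-1).
Proof.
move=> z1 y; apply: cvgV; first by have := clamp01_itv y; lra.
by apply: cvgB; [exact: cvg_cst|exact: continuous_clamp01].
Qed.

Lemma empirical_mean_clamp01 (f : R -> R) n (x : n.-tuple R') : unit_cube x ->
  empirical_mean (f \o clamp01) x = empirical_mean f x.
Proof.
move=> x01; rewrite /empirical_mean; congr (_ * _); apply: eq_bigr => i _.
by rewrite /= clamp01_id//; exact: x01.
Qed.

(** The clamped summand is continuous on the whole line, which gives
    measurability; on the cube the mean is [stieltjes_mean]. *)
Definition loop_event z al ga eps sg n : set (n.-tuple R') :=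
  [set x | eps <=
     sg * loop_poly z al ga (empirical_mean (fun y => (z - clamp01 y)^-1) x)].

Lemma measurable_loop_event z al ga eps sg n : 1 < z ->
  measurable (loop_event z al ga eps sg (n := n)).
Proof.
move=> z1; pose g (x : n.-tuple R') :=
  sg * loop_poly z al ga (empirical_mean (fun y => (z - clamp01 y)^-1) x).
have mg : measurable_fun setT g.
  have mG := @measurable_empirical_mean _ n (continuous_inv_clamp01 z1).
  apply: measurable_funM => //; apply: measurable_funB => //.
  apply: measurable_funD; apply: measurable_funM => //.
  exact: measurable_funX.
rewrite (_ : loop_event z al ga eps sg (n := n) = g @^-1` `[eps, +oo[).
  by rewrite -[X in measurable X]setTI; exact: mg.
by apply/seteqP; split => x; rewrite /loop_event /= in_itv/= andbT.
Qed.

(** If the quadratic polynomial of the loop equation differs from 0 by eps,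
    then the deformation, run in the direction given by its sign for a fixed
    small time, multiplies the weight by a factor exponential in n * T, with
    T = n1 + n2 - n >= n / 2, while it shrinks volumes by at most 2 ^ n. *)
Lemma loop_event_tail z eps beta : 1 < z -> 0 < eps -> 0 < beta ->
  exists c M : R, 0 < c /\ forall n (n1 n2 sg : R), (4 <= n)%N ->
    n%:R - 1 < n1 -> n%:R - 1 < n2 -> `|sg| = 1 ->
    (jacobi_ensemble n1 n2 beta
      (loop_event z (n%:R / (n1 + n2 - n%:R))
         ((n1 - n%:R) / (n1 + n2 - n%:R)) eps sg (n := n))
     <= (expR (n%:R * M - n%:R ^+ 2 * c))%:E)%E.
Proof.
move=> z1 eps0 beta0.
set C := deform_rate z; have C1 : 1 <= C := deform_rate_ge1 z1.
have C0 : 0 < C by lra.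
(* The time tau makes the quadratic error 2 tau ^ 2 C ^ 2 beta n T at most half
   of the linear gain tau (beta / 2) n T eps. *)
have [tau [tau0 tau8 tauC]] : exists tau : R,
    [/\ 0 < tau, 8 * tau * C ^+ 2 <= eps & tau * C <= 2^-1].
  pose tau := eps / (8 * C ^+ 2 * (1 + eps)).
  have CC : 0 < C ^+ 2 by rewrite exprn_gt0.
  have d0 : 0 < 8 * C ^+ 2 * (1 + eps) by apply: mulr_gt0; [apply: mulr_gt0|]; lra.
  have tau0 : 0 < tau by rewrite divr_gt0.
  have tauE : tau * (8 * C ^+ 2 * (1 + eps)) = eps by rewrite /tau divfK// gt_eqF.
  have tau8 : 8 * tau * C ^+ 2 <= eps.
    rewrite -[leRHS]tauE.
    have : 0 <= tau * C ^+ 2 * eps by apply/ltW; rewrite mulr_gt0// mulr_gt0.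
    by lra.
  have tauC : tau * C <= 2^-1.
    have tC0 : 0 <= tau * C by apply/ltW; rewrite mulr_gt0.
    have : tau * C * 1 <= tau * C * C by apply: ler_wpM2l.
    have : 8 * (tau * C ^+ 2) * (1 + eps) <= 1 + eps by lra.
    rewrite ger_pMl; last by lra.
    by rewrite expr2; lra.
  by exists tau.
exists (tau * beta * eps / 8),
  (1 + tau * 2 * (beta + 1) * C + 4 * tau ^+ 2 * C ^+ 2 * (beta + 1)).
split; first by rewrite !mulr_gt0// invr_gt0.
move=> n n1 n2 sg n4 hn1 hn2 sg1.
have n4' : (4 : R) <= n%:R by rewrite (ler_nat R 4).
set N : R := n%:R in n4' hn1 hn2 *.
set T := n1 + n2 - N; have T0 : N / 2 <= T by rewrite /T; lra.
set al := N / T; set ga := (n1 - N) / T.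
pose t := - (sg * tau).
have tE : `|t| = tau by rewrite normrN normrM sg1 mul1r gtr0_norm.
have tz : `|t| * deform_rate z <= 2^-1 by rewrite tE.
set m := N * (tau * 2 * (beta + 1) * C + 4 * tau ^+ 2 * C ^+ 2 * (beta + 1)).
apply: (@le_trans _ _ (2 ^+ n / expR (N ^+ 2 * (tau * beta * eps / 8) - m))%:E).
  apply: (@jacobi_ensemble_le _ _ _ _ _ _ _ (deform z t)) => //.
  - exact: expR_gt0.
  - exact: deform_coLipschitz.
  - exact: measurable_deform.
  - exact: measurable_loop_event.
  move=> x; rewrite /loop_event /=.
  rewrite (_ : (fun y => _) = (fun y => (z - y)^-1) \o clamp01)// => + x01.
  rewrite empirical_mean_clamp01// -/(stieltjes_mean z x) => qx.
  split; first by move=> i; rewrite tnth_map; apply: deform_itv => //; exact: x01.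
  set a := beta / 2 * (n1 - N + 1) - 1; set b := beta / 2 * (n2 - N + 1) - 1.
  apply: le_trans (jacobi_weight_deform z1 tz beta0 x01 (erefl a) (erefl b)).
  apply: ler_wpM2r; first exact: jacobi_weight_ge0.
  rewrite ler_expR.
  have n0 : (0 < n)%N by apply: leq_trans n4.
  have TT : 0 < T by lra.
  have := log_weight_drift_loop n0 z1 beta0 x01 (erefl a) (erefl b) (erefl T) TT.
  rewrite -/al -/ga -/N -/C -/a -/b.
  set D := log_weight_drift _ _ _ _ _.
  set q := loop_poly _ _ _ _ in qx *; set E := D + _ => err.
  have tD : - (tau * (N * (2 * (beta + 1) * C))) +
      tau * (beta / 2 * N * T * eps) <= t * D.
    have -> : t * D = t * E + tau * (beta / 2 * N * T * (sg * q)).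
      by rewrite /t /E; ring.
    apply: lerD.
      apply: (@le_trans _ _ (- `|t * E|)); last by have := ler_norm (- (t * E)); rewrite normrN; lra.
      by rewrite lerN2 normrM tE; apply: ler_wpM2l => //; exact: ltW.
    apply: ler_wpM2l; first exact: ltW.
    by apply: ler_wpM2l => //; rewrite !mulr_ge0//; lra.
  have absum : N * (`|a| + `|b|) + N ^+ 2 * beta <= N * (beta * T + 2 * beta + 2).
    have -> : N * (`|a| + `|b|) + N ^+ 2 * beta = N * (`|a| + `|b| + N * beta).
      by ring.
    have N0 : 0 <= N by lra.
    apply: ler_wpM2l => //.
    have a1 : `|a| <= beta / 2 * (n1 - N + 1) + 1.
      have : 0 <= beta / 2 * (n1 - N + 1) by rewrite !mulr_ge0//; lra.
      by rewrite /a ler_norml; lra.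
    have b1 : `|b| <= beta / 2 * (n2 - N + 1) + 1.
      have : 0 <= beta / 2 * (n2 - N + 1) by rewrite !mulr_ge0//; lra.
      by rewrite /b ler_norml; lra.
    have : 0 <= beta / 2 * (T + 2 - N) by rewrite !mulr_ge0// /T; lra.
    by rewrite /T; lra.
  rewrite -/C -[t ^+ 2]real_normK ?num_real// tE.
  have tt : 0 <= 2 * tau ^+ 2 * C ^+ 2.
    by rewrite mulr_ge0 ?sqr_ge0// mulr_ge0 ?sqr_ge0.
  have := ler_wpM2l tt absum.
  have N0 : 0 < N by lra.
  have s1 : 0 <= tau * (beta * N * T).
    by rewrite mulr_ge0 ?mulr_ge0//; lra.
  have s2 := ler_wpM2l s1 tau8.
  have s3 : 0 <= tau * beta * eps * N * (T - N / 2).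
    apply: mulr_ge0; last by lra.
    by apply: mulr_ge0; [rewrite mulr_ge0 ?mulr_ge0//; lra|lra].
  by rewrite /m; lra.
rewrite lee_fin -expRN; apply: (@le_trans _ _ (expR N *
    expR (- (N ^+ 2 * (tau * beta * eps / 8) - m)))).
  apply: ler_wpM2r; first exact: expR_ge0.
  rewrite -[N]mulr1 /N expRM_natl; apply: lerXn2r; rewrite ?nnegrE ?expR_ge0//.
  by have := expR_ge1Dx (1 : R); lra.
by rewrite -expRD ler_expR /m; lra.
Qed.

End concentration.

(** * Polynomial approximation *)

Section bernstein.
Context {R : realType}.
Implicit Types (x c e M : R) (h : R -> R).

(** Expectation of h (S) for S binomial with parameters n and x, defined by
    conditioning on one trial; Bernstein polynomials in recursive form. *)
Fixpoint binomial_mean x n h : R :=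
  if n is n'.+1 then
    (1 - x) * binomial_mean x n' h + x * binomial_mean x n' (fun s => h (s + 1))
  else h 0.

Lemma binomial_mean_poly n h :
  exists p : {poly R}, forall x, binomial_mean x n h = p.[x].
Proof.
elim: n h => [|n IHn] h; first by exists (h 0)%:P => x; rewrite hornerC.
have [p hp] := IHn h; have [q hq] := IHn (fun s => h (s + 1)).
by exists ((1 - 'X) * p + 'X * q) => x; rewrite /= hp hq !hornerE.
Qed.

Lemma binomial_mean_le x n h1 h2 : 0 <= x <= 1 -> (forall s, h1 s <= h2 s) ->
  binomial_mean x n h1 <= binomial_mean x n h2.
Proof.
move=> /andP[x0 x1]; elim: n h1 h2 => [|n IHn] h1 h2 h12 /=; first exact: h12.
by apply: lerD; apply: ler_wpM2l; rewrite ?subr_ge0//; apply: IHn => s.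
Qed.

Lemma binomial_mean_square x n (a b c : R) :
  binomial_mean x n (fun s => a + b * (s + c) ^+ 2) =
  a + b * ((n%:R * x + c) ^+ 2 + n%:R * (x * (1 - x))).
Proof.
elim: n c => [|n IHn] c /=; first by ring.
rewrite IHn (_ : (fun s => _) = (fun s => a + b * (s + (c + 1)) ^+ 2)).
  by rewrite IHn -natr1; ring.
by apply/funext => s; congr (_ + _ * _ ^+ 2); ring.
Qed.

(** Heine's theorem, with only one of the two points in the compact interval. *)
Lemma uniform_continuity_itv (f : R -> R) e : continuous f -> 0 < e ->
  exists2 d, 0 < d & forall x s, 0 <= x <= 1 -> `|s - x| < d -> `|f s - f x| <= e.
Proof.
move=> cf e0.
have /compact_near_coveringP cov := @segment_compact R 0 1.
have : \forall d \near 0^'+, `[0, 1] `<=` (fun x => forall s, `|s - x| < d ->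
    `|f s - f x| <= e).
  apply: cov => x _.
  have e2 : 0 < e / 2 by lra.
  have /cvgrPdist_lt/(_ _ e2) := cf x; move=> /nbhs_ballP[r /= r0 rf].
  exists (ball x (r / 2), [set d | d < r / 2]) => /=.
    split; first by apply: nbhsx_ballx; rewrite divr_gt0.
    by apply: nbhs_right_lt; rewrite divr_gt0.
  move=> [y d] /= [xy dr] s sy.
  have fy : `|f x - f y| < e / 2.
    by apply: rf; apply: (lt_le_trans xy); lra.
  have fs : `|f x - f s| < e / 2.
    apply: rf; have xy' : `|x - y| < r / 2 by exact: xy.
    have : `|x - s| < r; last by [].
    by have := ler_distD y x s; rewrite (distrC y s); lra.
  have := ler_distD (f x) (f s) (f y); rewrite (distrC (f s) (f x)); lra.
move=> H.
have [d [d0 dH]] : exists d : R, 0 < d /\ `[0, 1] `<=` (fun x => forall s,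
    `|s - x| < d -> `|f s - f x| <= e).
  have : \forall d \near 0^'+, 0 < d /\ `[0, 1] `<=` (fun x => forall s,
    `|s - x| < d -> `|f s - f x| <= e).
    by near=> d; split; near: d; [exact: nbhs_right_gt|exact: H].
  by move/(@filter_ex _ _ _) => [d ?]; exists d.
by exists d => // x s x01; apply: dH; rewrite /= in_itv.
Unshelve. all: by end_near. Qed.

(** Bernstein's proof: f (S / n) is close to f (x) on average because S / n has
    mean x and variance x (1 - x) / n. *)
Lemma weierstrass (f : R -> R) M e : continuous f -> (forall s, `|f s| <= M) ->
  0 < e -> exists p : {poly R}, forall x, 0 <= x <= 1 -> `|f x - p.[x]| <= e.
Proof.
move=> cf fM e0.
have e2 : 0 < e / 2 by lra.
have [d d0 fd] := uniform_continuity_itv cf e2.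
have M0 : 0 <= M by apply: le_trans (fM 0); exact: normr_ge0.
pose K := 2 * M / d ^+ 2.
have K0 : 0 <= K by apply: divr_ge0; [rewrite mulr_ge0|exact: sqr_ge0].
have fK x s : 0 <= x <= 1 -> `|f s - f x| <= e / 2 + K * (s - x) ^+ 2.
  move=> x01; have [sx|sx] := ltP `|s - x| d.
    apply: le_trans (fd _ _ x01 sx) _.
    by rewrite lerDl mulr_ge0// sqr_ge0.
  apply: le_trans (ler_normB _ _) _.
  apply: (@le_trans _ _ (2 * M)); first by have := fM s; have := fM x; lra.
  have : 2 * M * d ^+ 2 <= 2 * M * (s - x) ^+ 2.
    apply: ler_wpM2l; first by lra.
    rewrite -[(s - x) ^+ 2]real_normK ?num_real// lerXn2r ?nnegrE//.
    exact: ltW.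
  rewrite -ler_pdivlMr ?exprn_gt0// mulrAC -/K => H.
  by rewrite (le_trans H)// lerDr ltW.
pose n := (Num.truncn (2 * K / e)).+1.
have n0 : 0 < n%:R :> R by rewrite ltr0n.
have nK : K / n%:R <= e / 2.
  rewrite ler_pdivrMr//; have : 2 * K / e < n%:R by exact: truncnS_gt.
  by rewrite ltr_pdivrMr//; lra.
have [p pE] := binomial_mean_poly n (fun s => f (s / n%:R)).
exists p => x x01; rewrite -pE.
have /andP[x0 x1] := x01.
have sE s : (s / n%:R - x) ^+ 2 = n%:R^-1 ^+ 2 * (s + - (n%:R * x)) ^+ 2.
  by rewrite -exprMn; congr (_ ^+ 2); field; rewrite gt_eqF.
have var : K * (n%:R^-1 ^+ 2 * (n%:R * (x * (1 - x)))) <= e / 2.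
  have -> : K * (n%:R^-1 ^+ 2 * (n%:R * (x * (1 - x)))) =
      K / n%:R * (x * (1 - x)) by field; rewrite gt_eqF.
  apply: le_trans nK; apply: ler_piMr; first by rewrite divr_ge0.
  by have := sqr_ge0 (x - 2^-1); rewrite expr2; lra.
have up : binomial_mean x n (fun s => f (s / n%:R)) <= f x + e.
  apply: (@le_trans _ _ (binomial_mean x n
      (fun s => (f x + e / 2) + K * n%:R^-1 ^+ 2 * (s + - (n%:R * x)) ^+ 2))).
    apply: binomial_mean_le => // s; rewrite -mulrA -sE.
    by have := fK _ (s / n%:R) x01; rewrite ler_norml; lra.
  by rewrite binomial_mean_square subrr expr0n/= add0r -mulrA; lra.
have lo : f x - e <= binomial_mean x n (fun s => f (s / n%:R)).
  apply: (@le_trans _ _ (binomial_mean x n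
      (fun s => (f x - e / 2) + - (K * n%:R^-1 ^+ 2) * (s + - (n%:R * x)) ^+ 2))).
    by rewrite binomial_mean_square subrr expr0n/= add0r mulNr -mulrA; lra.
  apply: binomial_mean_le => // s; rewrite mulNr -mulrA -sE.
  by have := fK _ (s / n%:R) x01; rewrite ler_norml; lra.
by rewrite ler_norml; lra.
Qed.

End bernstein.

(** * Convergence in probability of linear statistics *)

Section linear_statistics.
Context {R : realType}.
Local Notation R' := (measurableTypeR R).
Variables (beta : R) (n1 n2 : nat -> R).
Hypothesis hbeta : 0 < beta.
Hypothesis hn1 : forall n, (0 < n)%N -> n%:R - 1 < n1 n.
Hypothesis hn2 : forall n, (0 < n)%N -> n%:R - 1 < n2 n.
Variables (d : nat -> measure_display) (T : forall n, measurableType (d n)).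
Variables (P : forall n, probability (T n) R).
Variable X : forall n, {RV (P n) >-> n.-tuple (measurableTypeR R)}.
Hypothesis hX01 : forall n, (0 < n)%N -> forall w, unit_cube (X n w).
Hypothesis hXlaw : forall n, (0 < n)%N -> forall A, measurable A ->
  distribution (P n) (X n) A = jacobi_ensemble (n1 n) (n2 n) beta A.

Implicit Types (a b e eps : R).
Local Notation prob n A := (P n (X n @^-1` A)).

Definition deviation (f : R -> R) (c eps : R) n : set (n.-tuple R') :=
  [set x | eps <= `|empirical_mean f x - c|].
Arguments deviation f c eps n : clear implicits.

Lemma measurable_deviation (f : R -> R) c eps n : continuous f ->
  measurable (deviation f c eps n).
Proof.
move=> cf; pose g (x : n.-tuple R') := `|empirical_mean f x - c|.
have mg : measurable_fun setT g.
  apply: measurableT_comp => //; apply: measurable_funB => //.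
  exact: measurable_empirical_mean.
rewrite (_ : deviation f c eps n = g @^-1` `[eps, +oo[).
  by rewrite -[X in measurable X]setTI; exact: mg.
by apply/seteqP; split => x; rewrite /deviation /= in_itv/= andbT.
Qed.

Arguments measurable_deviation {f} c eps n.

Lemma measurable_preimage_rv n (A : set (n.-tuple R')) : measurable A ->
  measurable (X n @^-1` A).
Proof. by move=> mA; rewrite -[Y in measurable Y]setTI; apply: measurable_funP. Qed.

Lemma prob_le n (A B : set (n.-tuple R')) : (0 < n)%N ->
  measurable A -> measurable B -> (forall x, unit_cube x -> A x -> B x) ->
  (prob n A <= prob n B)%E.
Proof.
move=> n0 mA mB AB; apply: le_measure; rewrite ?inE;
  [exact: measurable_preimage_rv..|].
by move=> w; apply: AB; exact: hX01.
Qed.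

Lemma prob_setU_le n (A B : set (n.-tuple R')) :
  measurable A -> measurable B -> (prob n (A `|` B) <= prob n A + prob n B)%E.
Proof.
by move=> mA mB; rewrite preimage_setU; apply: measureU2;
  exact: measurable_preimage_rv.
Qed.

Lemma cvge0_le (u v : nat -> \bar R) : (forall n, 0 <= u n)%E ->
  (\forall n \near \oo, u n <= v n)%E -> v n @[n --> \oo] --> 0%E ->
  u n @[n --> \oo] --> 0%E.
Proof.
move=> u0 uv v0; apply: (@squeeze_cvge _ _ _ _ (cst 0%E) _ v) => //.
  by apply: filterS uv => n unv; rewrite u0.
exact: cvg_cst.
Qed.

Lemma expR_quadratic_cvg0 (M c : R) : 0 < c ->
  (expR (n%:R * M - n%:R ^+ 2 * c))%:E @[n --> \oo] --> 0%E.
Proof.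
move=> c0; apply: (@cvge0_le _ (fun n => (expR (- n%:R))%:E)).
- by move=> n; rewrite lee_fin expR_ge0.
- near=> n; rewrite lee_fin ler_expR.
  have : (`|M| + 1) / c <= n%:R by near: n; exact: nbhs_infty_ger.
  rewrite ler_pdivrMr// => H; have := ler_norm M.
  have := ler_wpM2l (ler0n R n) H.
  have := ler0n R n; rewrite expr2; nra.
- apply: cvg_EFin; first exact: nearW.
  exact: (cvg_comp _ _ (@cvgr_idn R) (@cvgr_expR R)).
Unshelve. all: by end_near. Qed.

(** Between its nonnegative root and any point above 1 / z, where all Stieltjes
    means lie, the loop polynomial has slope at least z - 1; so it is small only
    near that root. *)
Lemma loop_poly_diff_ge (z al ga g G : R) : 1 < z -> 0 <= al -> al + ga <= 1 ->
  0 <= g -> z^-1 <= G -> loop_poly z al ga g = 0 ->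
  (z - 1) * `|G - g| <= `|loop_poly z al ga G|.
Proof.
move=> z1 al0 alga g0 Gz lg.
have -> : loop_poly z al ga G =
    (al * (z - 1) * (z * (G + g) - 1) + (z - al - ga)) * (G - g).
  rewrite -[LHS]subr0 -{1}lg /loop_poly; ring.
have z0 : 0 < z by lra.
have zG : 1 <= z * G by have := ler_wpM2l (ltW z0) Gz; rewrite mulfV ?gt_eqF.
rewrite normrM; apply: ler_wpM2r => //.
have H : 0 <= al * (z - 1) * (z * (G + g) - 1).
  rewrite !mulr_ge0//; first by lra.
  by have := mulr_ge0 (ltW z0) g0; lra.
by rewrite ger0_norm; lra.
Qed.

Lemma loop_poly_params_le (z al ga al' ga' G : R) : 1 < z ->
  0 <= G <= (z - 1)^-1 ->
  `|loop_poly z al ga G - loop_poly z al' ga' G| <=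
    (2 * deform_rate z) * (`|al - al'| + `|ga - ga'|).
Proof.
move=> z1 /andP[G0 G1].
have -> : loop_poly z al ga G - loop_poly z al' ga' G =
    (al - al') * (z * ((z - 1) * G) * G - z * G) - (ga - ga') * G.
  by rewrite /loop_poly; ring.
have z0 : 0 < z - 1 by lra.
have zG : (z - 1) * G <= 1.
  by have := ler_wpM2l (ltW z0) G1; rewrite mulfV ?gt_eqF.
have zGC : z * G <= deform_rate z.
  by rewrite /deform_rate; apply: ler_wpM2l => //; lra.
have zG0 : 0 <= z * G by rewrite mulr_ge0//; lra.
have GC : G <= deform_rate z.
  by apply: le_trans zGC; rewrite ler_peMl//; lra.
apply: le_trans (ler_normB _ _) _; rewrite [X in _ <= X]mulrDr; apply: lerD.
  rewrite normrM mulrC; apply: ler_wpM2r => //.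
  have -> : z * ((z - 1) * G) * G - z * G = - ((z * G) * (1 - (z - 1) * G)).
    by ring.
  have m0 : 0 <= (z - 1) * G by rewrite mulr_ge0// ltW.
  rewrite normrN ger0_norm; last by rewrite mulr_ge0// subr_ge0.
  apply: (@le_trans _ _ (z * G)); last by lra.
  by rewrite ler_piMr// lerBlDr lerDl.
rewrite normrM mulrC; apply: ler_wpM2r => //.
by rewrite ger0_norm//; lra.
Qed.

(** If the Stieltjes mean is eps away from g, then the limiting loop polynomial
    has size at least (z - 1) eps there; the one with the parameters of index n
    is eventually at least half of that, which has exponentially small
    probability. *)
Lemma stieltjes_cvg (z al ga g : R) : 1 < z -> 0 <= al -> al + ga <= 1 -> 0 <= g ->
  loop_poly z al ga g = 0 ->
  n%:R / (n1 n + n2 n - n%:R) @[n --> \oo] --> al ->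
  (n1 n - n%:R) / (n1 n + n2 n - n%:R) @[n --> \oo] --> ga ->
  cvg_in_probability P
    (fun n w => empirical_mean (fun y => (z - clamp01 y)^-1) (X n w)) g.
Proof.
move=> z1 al0 alga g0 lg aln gan eps eps0.
pose dl := (z - 1) * eps / 2.
have dl0 : 0 < dl by rewrite divr_gt0// mulr_gt0// subr_gt0.
have [c [M [c0 tail]]] := loop_event_tail z1 dl0 hbeta.
have C1 := deform_rate_ge1 z1.
pose u n : \bar R := (expR (n%:R * M - n%:R ^+ 2 * c))%:E.
apply: (@cvge0_le _ (fun n => u n + u n)%E) => [n||].
- exact: measure_ge0.
- near=> n.
  have n0 : (0 < n)%N by near: n; exact: nbhs_infty_gt.
  have n4 : (4 <= n)%N by near: n; exact: nbhs_infty_ge.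
  have da : `|al - n%:R / (n1 n + n2 n - n%:R)| <= dl / (4 * deform_rate z).
    by near: n; move/cvgrPdist_le : aln; apply; rewrite divr_gt0// mulr_gt0//; lra.
  have db : `|ga - (n1 n - n%:R) / (n1 n + n2 n - n%:R)| <=
      dl / (4 * deform_rate z).
    by near: n; move/cvgrPdist_le : gan; apply; rewrite divr_gt0// mulr_gt0//; lra.
  set aln' := n%:R / (n1 n + n2 n - n%:R) in da *.
  set gan' := (n1 n - n%:R) / (n1 n + n2 n - n%:R) in db *.
  have lt sg : `|sg| = 1 -> (prob n (loop_event z aln' gan' dl sg (n := n)) <= u n)%E.
    move=> sg1; have := tail n (n1 n) (n2 n) sg n4 (hn1 n0) (hn2 n0) sg1.
    by rewrite -hXlaw//; exact: measurable_loop_event.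
  have mL sg : measurable (loop_event z aln' gan' dl sg (n := n)).
    exact: measurable_loop_event.
  apply: (@le_trans _ _ (prob n (loop_event z aln' gan' dl 1 (n := n) `|`
                                 loop_event z aln' gan' dl (- 1) (n := n)))%E).
    apply: (prob_le n0 (A := deviation (fun y => (z - clamp01 y)^-1) g eps n)).
    + exact: (measurable_deviation _ _ _ (continuous_inv_clamp01 z1)).
    + exact: measurableU.
    move=> x x01; rewrite /deviation /loop_event/=.
    have := stieltjes_mean_itv n0 z1 x01.
    rewrite /stieltjes_mean -empirical_mean_clamp01//.
    rewrite (_ : _ \o clamp01 = (fun y => (z - clamp01 y)^-1))//.
    set G := empirical_mean _ _ => /andP[G1 G2] epsG.
    have lG := loop_poly_diff_ge z1 al0 alga g0 G1 lg.
    have G0 : 0 <= G <= (z - 1)^-1.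
      by rewrite G2 andbT (le_trans _ G1)// invr_ge0; lra.
    have lG' := loop_poly_params_le al ga aln' gan' z1 G0.
    have E1 : (z - 1) * eps <= (z - 1) * `|G - g| by apply: ler_wpM2l => //; lra.
    have E2 : 2 * deform_rate z * (`|al - aln'| + `|ga - gan'|) <= dl.
      apply: (@le_trans _ _ (2 * deform_rate z *
        (dl / (4 * deform_rate z) + dl / (4 * deform_rate z)))).
        by apply: ler_wpM2l; lra.
      by rewrite le_eqVlt; apply/orP; left; apply/eqP; field; lra.
    have : dl <= `|loop_poly z aln' gan' G|.
      have := ler_distD 0 (loop_poly z al ga G) (loop_poly z aln' gan' G).
      have := ler_normB (loop_poly z al ga G - loop_poly z aln' gan' G)
        (- loop_poly z aln' gan' G).
      by rewrite opprK subrK normrN /dl; move: E2 lG lG' E1; rewrite /dl; lra.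
    by rewrite mul1r mulN1r ler_normr => /orP.
  apply: le_trans (prob_setU_le (mL 1) (mL (-1))) _.
  by apply: leeD; apply: lt; rewrite ?normrN normr1.
- rewrite -[X in _ --> X]adde0; apply: cvgeD => //; exact: expR_quadratic_cvg0.
Unshelve. all: by end_near. Qed.

(** ** Extension from Stieltjes transforms to continuous functions *)

(** [Lam f] is the candidate limit of the empirical means of f. Linearity and
    boundedness make the set of f for which it is correct a closed subspace. *)
Variable Lam : (R -> R) -> R.
Variable CLam : R.
Hypothesis Lam_linear : forall (a b : R) (f g : R -> R), continuous f -> continuous g ->
  Lam (fun x => a * f x + b * g x) = a * Lam f + b * Lam g.
Hypothesis Lam_bounded : forall (f : R -> R) (e : R), continuous f ->
  (forall x, 0 <= x <= 1 -> `|f x| <= e) -> `|Lam f| <= CLam * e.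

Definition concentrates (f : R -> R) : Prop := continuous f /\
  cvg_in_probability P (fun n w => empirical_mean f (X n w)) (Lam f).

Lemma empirical_mean_linear n (x : n.-tuple R') a b (f g : R -> R) :
  empirical_mean (fun y => a * f y + b * g y) x =
  a * empirical_mean f x + b * empirical_mean g x.
Proof.
rewrite /empirical_mean big_split/= -!mulr_sumr.
by rewrite mulrDr; congr (_ + _); rewrite mulrCA.
Qed.

Lemma continuous_linear a b (f g : R -> R) : continuous f -> continuous g ->
  continuous (fun x => a * f x + b * g x).
Proof.
move=> cf cg x; apply: cvgD; apply: cvgM; try exact: cvg_cst.
  exact: cf.
exact: cg.
Qed.

Lemma concentrates_linear a b (f g : R -> R) : concentrates f ->
  concentrates g -> concentrates (fun x => a * f x + b * g x).
Proof.
move=> [cf Pf] [cg Pg]; have cfg := @continuous_linear a b _ _ cf cg.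
split=> // eps eps0; rewrite Lam_linear//.
pose e := eps / (2 * (`|a| + `|b| + 1)).
have ab0 : 0 < `|a| + `|b| + 1 by have := normr_ge0 a; have := normr_ge0 b; lra.
have e0 : 0 < e by rewrite divr_gt0// mulr_gt0.
apply: (@cvge0_le _ (fun n => prob n (deviation f (Lam f) e n) +
    prob n (deviation g (Lam g) e n))%E) => [n||].
- exact: measure_ge0.
- near=> n.
  have n0 : (0 < n)%N by near: n; exact: nbhs_infty_gt.
  have mf := measurable_deviation (Lam f) e n cf.
  have mg := measurable_deviation (Lam g) e n cg.
  apply: le_trans (prob_setU_le mf mg).
  apply: (prob_le n0 (A := deviation _ (a * Lam f + b * Lam g) eps n)).
  + exact: measurable_deviation.
  + exact: measurableU.
  move=> x x01; rewrite /deviation/= empirical_mean_linear => H.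
  have [|f1] := leP e `|empirical_mean f x - Lam f|; first by left.
  have [|g1] := leP e `|empirical_mean g x - Lam g|; first by right.
  exfalso; move: H; apply/negP; rewrite -ltNge.
  have -> : a * empirical_mean f x + b * empirical_mean g x -
     (a * Lam f + b * Lam g) = a * (empirical_mean f x - Lam f) +
     b * (empirical_mean g x - Lam g) by ring.
  apply: le_lt_trans (ler_normD _ _) _; rewrite !normrM.
  apply: (@le_lt_trans _ _ (`|a| * e + `|b| * e)).
    by apply: lerD; apply: ler_wpM2l => //; exact: ltW.
  have eE : e * (2 * (`|a| + `|b| + 1)) = eps by rewrite /e divfK// gt_eqF// mulr_gt0.
  have := mulr_ge0 (normr_ge0 a) (ltW e0); have := mulr_ge0 (normr_ge0 b) (ltW e0).
  by rewrite -eE; lra.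
- rewrite -[Y in _ --> Y]adde0; apply: cvgeD => //; [exact: Pf|exact: Pg].
Unshelve. all: by end_near. Qed.

Lemma concentrates_closed (f : R -> R) : continuous f ->
  (forall e, 0 < e -> exists2 g, concentrates g &
     forall x, 0 <= x <= 1 -> `|f x - g x| <= e) ->
  concentrates f.
Proof.
move=> cf fg; split=> // eps eps0.
pose e := eps / (2 * (2 + `|CLam|)).
have C0 : 0 < 2 + `|CLam| by have := normr_ge0 CLam; lra.
have e0 : 0 < e by rewrite divr_gt0// mulr_gt0.
have [g [cg Pg] fge] := fg _ e0.
have eps2 : 0 < eps / 2 by lra.
apply: (@cvge0_le _ (fun n => prob n (deviation g (Lam g) (eps / 2) n))) => [n||].
- exact: measure_ge0.
- near=> n.
  have n0 : (0 < n)%N by near: n; exact: nbhs_infty_gt.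
  apply: (prob_le n0 (A := deviation f (Lam f) eps n)).
  + exact: measurable_deviation.
  + exact: measurable_deviation.
  move=> x x01; rewrite /deviation/=.
  have Lfg : `|Lam f - Lam g| <= `|CLam| * e.
    have -> : Lam f - Lam g = Lam (fun x => 1 * f x + (- 1) * g x).
      by rewrite Lam_linear// mul1r mulN1r.
    apply: (@le_trans _ _ (CLam * e)).
      apply: Lam_bounded; first exact: continuous_linear.
      by move=> y y01; rewrite mul1r mulN1r; exact: fge.
    by apply: ler_wpM2r; [exact: ltW|exact: ler_norm].
  have efg : `|empirical_mean f x - empirical_mean g x| <= e.
    have -> : empirical_mean f x - empirical_mean g x =
        empirical_mean (fun y => 1 * f y + (- 1) * g y) x.
      by rewrite empirical_mean_linear mul1r mulN1r.
    rewrite /empirical_mean normrM ger0_norm ?invr_ge0// ler_pdivrMl ?ltr0n//.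
    apply: le_trans (ler_norm_sum _ _ _) _.
    rewrite mulr_natl -[Y in _ *+ Y]card_ord -sumr_const; apply: ler_sum => i _.
    by rewrite mul1r mulN1r; apply: fge; exact: x01.
  have eE : e * (2 * (2 + `|CLam|)) = eps by rewrite /e divfK// gt_eqF// mulr_gt0.
  move=> H.
  have := ler_distD (empirical_mean g x) (empirical_mean f x) (Lam f).
  have := ler_distD (Lam g) (empirical_mean g x) (Lam f).
  rewrite (distrC (Lam g)); have : 0 <= e * 1 by rewrite mulr1 ltW.
  by move: eE; lra.
- exact: Pg.
Unshelve. all: by end_near. Qed.

Hypothesis Lam_stieltjes : forall z, 1 < z ->
  cvg_in_probability P
    (fun n w => empirical_mean (fun y => (z - clamp01 y)^-1) (X n w))
    (Lam (fun y => (z - clamp01 y)^-1)).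

(** Multiplying x ^ k / (z - x) by z and letting z grow gives x ^ k, and
    x ^ (k + 1) / (z - x) = z x ^ k / (z - x) - x ^ k. *)
Lemma concentrates_monomial k :
  (forall z, 1 < z -> concentrates (fun x => clamp01 x ^+ k * (z - clamp01 x)^-1)) /\
  concentrates (fun x => clamp01 x ^+ k).
Proof.
have step j : (forall z, 1 < z ->
    concentrates (fun x => clamp01 x ^+ j * (z - clamp01 x)^-1)) ->
    concentrates (fun x => clamp01 x ^+ j).
  move=> cj; apply: concentrates_closed.
    move=> x; apply: (@continuous_comp _ _ _ (@clamp01 R) (fun y : R => y ^+ j)).
      exact: continuous_clamp01.
    exact: exprn_continuous.
  move=> e e0; pose z := 1 + e^-1.
  have ei : 0 < e^-1 by rewrite invr_gt0.
  have z1 : 1 < z by rewrite /z; lra.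
  exists (fun x => z * (clamp01 x ^+ j * (z - clamp01 x)^-1) +
      0 * (clamp01 x ^+ j * (z - clamp01 x)^-1)).
    by apply: concentrates_linear; exact: cj.
  move=> x x01; rewrite clamp01_id//; have /andP[x0 x1] := x01.
  have zx : 0 < z - x by lra.
  have -> : x ^+ j - (z * (x ^+ j * (z - x)^-1) + 0 * (x ^+ j * (z - x)^-1)) =
      - (x ^+ j.+1 * (z - x)^-1) by rewrite exprS; field; lra.
  have xj : 0 <= x ^+ j.+1 <= 1 by rewrite exprn_ge0// exprn_ile1.
  have /andP[xj0 xj1] := xj.
  rewrite normrN ger0_norm; last by rewrite mulr_ge0// invr_ge0 ltW.
  rewrite ler_pdivrMr//; apply: le_trans xj1 _.
  apply: (@le_trans _ _ (e * e^-1)); first by rewrite mulfV// gt_eqF.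
  by apply: ler_wpM2l; [exact: ltW|rewrite /z; lra].
elim: k => [|k [cz ck]].
  have c0 z : 1 < z -> concentrates (fun x => clamp01 x ^+ 0 * (z - clamp01 x)^-1).
    move=> z1; rewrite (_ : (fun x => _) = (fun x => (z - clamp01 x)^-1)).
      by split; [exact: continuous_inv_clamp01|exact: Lam_stieltjes].
    by apply/funext => x; rewrite expr0 mul1r.
  by split=> //; exact: step.
have ck1 z : 1 < z -> concentrates (fun x => clamp01 x ^+ k.+1 * (z - clamp01 x)^-1).
  move=> z1.
  rewrite (_ : (fun x => _) = (fun x => z * (clamp01 x ^+ k * (z - clamp01 x)^-1) +
      (- 1) * clamp01 x ^+ k)).
    by apply: concentrates_linear => //; exact: cz.
  apply/funext => x; have /andP[_ x1] := clamp01_itv x.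
  by rewrite exprS; field; lra.
by split=> //; exact: step.
Qed.

Lemma concentrates_poly (p : {poly R}) : concentrates (fun x => p.[clamp01 x]).
Proof.
have H m (a : nat -> R) : concentrates (fun x => \sum_(i < m) a i * clamp01 x ^+ i).
  elim: m => [|m IHm].
    have [_ c0] := concentrates_monomial 0.
    rewrite (_ : (fun x => _) = (fun x => 0 * clamp01 x ^+ 0 + 0 * clamp01 x ^+ 0)).
      exact: concentrates_linear.
    by apply/funext => x; rewrite big_ord0; ring.
  have [_ cm] := concentrates_monomial m.
  rewrite (_ : (fun x => _) = (fun x => 1 * (\sum_(i < m) a i * clamp01 x ^+ i) +
      a m * clamp01 x ^+ m)); first exact: concentrates_linear.
  by apply/funext => x; rewrite big_ord_recr mul1r.
rewrite (_ : (fun x => _) = (fun x => \sum_(i < size p) p`_i * clamp01 x ^+ i)) //.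
by apply/funext => x; rewrite horner_coef.
Qed.

Lemma linear_statistics_cvg (f : R -> R) : {within `[0, 1], continuous f} ->
  cvg_in_probability P (fun n w => empirical_mean f (X n w)) (Lam (f \o clamp01)).
Proof.
move=> cf.
have cfc := continuous_comp_clamp01 cf.
have [M fM] : exists M, forall s, `|(f \o clamp01) s| <= M.
  have cn : continuous (fun s => `|(f \o clamp01) s|).
    by move=> s; apply: cvg_norm; exact: cfc.
  have [c _ cM] := EVT_max (@ler01 R) (continuous_subspaceT cn).
  exists `|(f \o clamp01) c| => s.
  have := cM (clamp01 s); rewrite in_itv/= clamp01_itv => /(_ isT).
  by rewrite [clamp01 (clamp01 s)]clamp01_id// clamp01_itv.
have [_ H] : concentrates (f \o clamp01).
  apply: concentrates_closed => // e e0.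
  have [p pe] := weierstrass cfc fM e0.
  exists (fun x => p.[clamp01 x]); first exact: concentrates_poly.
  by move=> x x01; rewrite /= clamp01_id//; have := pe x x01; rewrite /= clamp01_id.
move=> eps eps0; have := H eps eps0.
apply: cvg_trans; apply: near_eq_cvg; near=> n.
have n0 : (0 < n)%N by near: n; exact: nbhs_infty_gt.
congr (P n _); apply/seteqP; split => w /=;
  by rewrite empirical_mean_clamp01//; exact: hX01.
Unshelve. all: by end_near. Qed.

End linear_statistics.

(** * Integrals with endpoint singularities *)

Section improper_integral.
Context {R : realType}.
Implicit Types (f F : R -> R) (a b A B x : R).

Lemma bigcup_itvcc_shrink a b : a < b ->
  \bigcup_k `[a + (b - a) / 3 * k.+1%:R^-1, b - (b - a) / 3 * k.+1%:R^-1]%classic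
  = `]a, b[%classic.
Proof.
move=> ab; have d0 : 0 < (b - a) / 3 by rewrite divr_gt0// subr_gt0.
have sub (x : R) k : a + (b - a) / 3 * k.+1%:R^-1 <= x
    <= b - (b - a) / 3 * k.+1%:R^-1 -> a < x < b.
  have : 0 < (b - a) / 3 * k.+1%:R^-1 by rewrite mulr_gt0// invr_gt0.
  by set e := _ / _ * _ => ? /andP[? ?]; apply/andP; split; lra.
have sup (x : R) : a < x < b -> exists k : nat, a + (b - a) / 3 * k.+1%:R^-1 <= x
    <= b - (b - a) / 3 * k.+1%:R^-1.
  move=> /andP[ax xb].
  have e0 : 0 < Num.min (x - a) (b - x) by rewrite lt_min !subr_gt0 ax.
  exists (Num.truncn ((b - a) / 3 / Num.min (x - a) (b - x))).
  set k := Num.truncn _.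
  have : (b - a) / 3 * k.+1%:R^-1 <= Num.min (x - a) (b - x).
    rewrite ler_pdivrMr// (mulrC (Num.min _ _)) -ler_pdivrMr//.
    by apply: ltW; exact: truncnS_gt.
  rewrite le_min; set e := _ / _ * _ => /andP[? ?].
  by apply/andP; split; lra.
apply/seteqP; split=> x /=.
  by move=> [k _]; rewrite /= !in_itv/=; exact: sub.
by rewrite in_itv/= => /sup[k xk]; exists k => //=; rewrite in_itv.
Qed.

(** The fundamental theorem of calculus on compact subintervals, followed by
    monotone convergence; F and f may be singular at both ends. *)
Lemma ge0_FTC_itvoo f F a b la lb : a < b ->
  (forall x, a < x < b -> 0 <= f x) ->
  (forall x, a < x < b -> {for x, continuous f}) ->
  (forall x, a < x < b -> is_derive x 1 F (f x)) ->
  F x @[x --> a^'+] --> la -> F x @[x --> b^'-] --> lb ->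
  (\int[lebesgue_measure]_(x in `]a, b[) (f x)%:E = (lb - la)%:E)%E.
Proof.
move=> ab f0 cf dF Fa Fb.
have [d dE] : exists d : R, d = (b - a) / 3 by eexists.
have d0 : 0 < d by rewrite dE divr_gt0// subr_gt0.
pose u k := a + d * k.+1%:R^-1; pose v k := b - d * k.+1%:R^-1.
have dk k : 0 < d * k.+1%:R^-1 <= d.
  by rewrite mulr_gt0//= ler_pdivrMr// ler_peMr ?ler1n// ltW.
have uv k : [/\ a < u k, u k < v k & v k < b].
  by have := dk k; rewrite /u /v; set e := d * _ => /andP[? ?]; split; lra.
have inab k (x : R) : `[u k, v k]%classic x -> a < x < b.
  by rewrite /= in_itv/=; have [? ? ?] := uv k; move=> /andP[? ?]; apply/andP; split; lra.
have cdk : (d * k.+1%:R^-1 : R) @[k --> \oo] --> 0.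
  rewrite -[X in _ --> X](mulr0 d); apply: cvgM; first exact: cvg_cst.
  exact: cvg_harmonic.
have cu : u k @[k --> \oo] --> a.
  by rewrite -[X in _ --> X]addr0; apply: cvgD => //; exact: cvg_cst.
have cv : v k @[k --> \oo] --> b.
  by rewrite -[X in _ --> X]subr0; apply: cvgB => //; exact: cvg_cst.
have FTC k : (\int[lebesgue_measure]_(x in `[u k, v k]) (f x)%:E =
    (F (v k) - F (u k))%:E)%E.
  have [au ukv vb] := uv k.
  have der x : x \in `[u k, v k] -> is_derive x 1 F (f x).
    by move=> xuv; apply: dF; apply: (inab k).
  rewrite (@continuous_FTC2 _ f F)//.
  - by apply: continuous_in_subspaceT => x; rewrite inE => xuv; apply/cf/(inab k).
  - have := @derivable_within_continuous R _ F `[u k, v k].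
    move=> /(_ _)/continuous_within_itvP => -[| |Fu Fv] //.
      by move=> x xuv; exact: (@ex_derive _ _ _ _ _ _ _ (der x xuv)).
    split => // x xuv; apply: (@ex_derive _ _ _ _ _ _ _ (der x _)).
    exact: subset_itv_oo_cc.
  - move=> x xuv; rewrite derive1E; apply: (@derive_val _ _ _ _ _ _ _ (der x _)).
    exact: subset_itv_oo_cc.
have cvgI : (\int[lebesgue_measure]_(x in `[u k, v k]) (f x)%:E)%E @[k --> \oo]
    --> (\int[lebesgue_measure]_(x in `]a, b[) (f x)%:E)%E.
  rewrite -(bigcup_itvcc_shrink ab) -dE.
  have H := @ge0_nondecreasing_set_cvg_integral _ (measurableTypeR R) R
    (fun k => `[u k, v k]%classic) (EFin \o f) lebesgue_measure.
  apply: H => //.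
  - move=> m n mn; apply/subsetPset => y /=; rewrite !in_itv/=.
    move: (y : R) => x; have : d * n.+1%:R^-1 <= d * m.+1%:R^-1.
      by apply: ler_wpM2l; [exact: ltW|rewrite lef_pV2 ?posrE// ler_nat].
    rewrite /u /v; set e := d * _; set e' := d * _.
    by move=> ? /andP[? ?]; apply/andP; split; lra.
  - move=> k; apply/measurable_EFinP; apply: subspace_continuous_measurable_fun => //.
    by apply: continuous_in_subspaceT => x; rewrite inE => xuv; apply/cf/(inab k).
  - by move=> k x xuv; rewrite lee_fin; apply/f0/(inab k).
have cvgF : (F (v k) - F (u k))%:E @[k --> \oo] --> (lb - la)%:E.
  apply: cvg_EFin; first exact: nearW.
  apply: cvgB.
    by move/cvg_at_leftP : Fb; apply; split => // k; have [] := uv k.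
  by move/cvg_at_rightP : Fa; apply; split => // k; have [] := uv k.
move: cvgI; under eq_cvg do rewrite FTC.
by move=> cvgI; exact: (cvg_unique _ cvgI cvgF).
Qed.

(** Antiderivative of A B (b - a) / ((A (b - x) + B (x - a)) r (x)) with
    r (x) ^ 2 = (x - a) (b - x); for A = |c - a| and B = |c - b| this is
    A B / (|c - x| r (x)). *)
Definition atan_primitive a b A B x : R :=
  2 * Num.sqrt (A * B) * atan (Num.sqrt (B / A) * Num.sqrt ((x - a) / (b - x))).

(** When A B = 0 the primitive and its derivative both vanish; this covers an
    edge of the support at 0 or 1. *)
Lemma atan_primitive_derive a b A B x : a < x < b -> 0 <= A -> 0 <= B ->
  is_derive x 1 (atan_primitive a b A B)
    (A * B * (b - a) / ((A * (b - x) + B * (x - a)) * Num.sqrt ((x - a) * (b - x)))).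
Proof.
move=> /andP[ax xb] A0 B0.
have [AB0|AB0] := eqVneq (A * B) 0.
  rewrite AB0 !mul0r (_ : atan_primitive a b A B = cst 0).
    exact: is_derive_cst.
  by apply/funext => y; rewrite /atan_primitive AB0 sqrtr0 mulr0 mul0r.
have Ap : 0 < A by rewrite lt_neqAle A0 andbT eq_sym; apply: contraNneq AB0 => ->; rewrite mul0r.
have Bp : 0 < B by rewrite lt_neqAle B0 andbT eq_sym; apply: contraNneq AB0 => ->; rewrite mulr0.
have xa0 : 0 < x - a by lra.
have bx0 : 0 < b - x by lra.
pose w y : R := (y - a) / (b - y).
have w0 : 0 < w x by rewrite divr_gt0.
have dw : is_derive x 1 w ((b - a) / (b - x) ^+ 2).
  have d1 : is_derive x 1 (fun y : R => y - a) 1.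
    by rewrite -[X in is_derive _ _ _ X]subr0; apply: is_deriveB.
  have d2 : is_derive x 1 (fun y : R => b - y) (- 1).
    by rewrite -[X in is_derive _ _ _ X]sub0r; apply: is_deriveB.
  have d3 : is_derive x 1 (fun y : R => (b - y)^-1) (- (b - x) ^- 2 *: (- 1)).
    by apply: is_deriveV => //; rewrite gt_eqF.
  have := is_deriveM d1 d3; rewrite (_ : _ * _ = w)// => dw.
  apply: is_derive_eq.
  by rewrite /GRing.scale/=; field; rewrite gt_eqF.
have ds : is_derive x 1 (fun y => Num.sqrt (w y))
    ((2 * Num.sqrt (w x))^-1 * ((b - a) / (b - x) ^+ 2)).
  have := @is_derive1_comp _ Num.sqrt w x _ _ (is_derive1_sqrt w0) dw.
  by [].
have dk : is_derive x 1 (fun y => Num.sqrt (B / A) * Num.sqrt (w y))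
    (Num.sqrt (B / A) * ((2 * Num.sqrt (w x))^-1 * ((b - a) / (b - x) ^+ 2))).
  exact: is_deriveZ.
have da : is_derive x 1 (fun y => atan (Num.sqrt (B / A) * Num.sqrt (w y)))
    ((1 + (Num.sqrt (B / A) * Num.sqrt (w x)) ^+ 2)^-1 *
    (Num.sqrt (B / A) * ((2 * Num.sqrt (w x))^-1 * ((b - a) / (b - x) ^+ 2)))).
  have := @is_derive1_comp _ atan _ x _ _ (is_derive1_atan _) dk.
  by [].
have := is_deriveZ (2 * Num.sqrt (A * B)) da.
rewrite (_ : _ \*: _ = atan_primitive a b A B)// => dT; apply: is_derive_eq.
rewrite /GRing.scale/= exprMn !sqr_sqrtr ?divr_ge0//; [|exact: ltW..].
rewrite !sqrtrM ?ltW// !sqrtrV ?ltW//.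
have := sqr_sqrtr A0; have := sqr_sqrtr B0.
have := sqr_sqrtr (ltW xa0); have := sqr_sqrtr (ltW bx0).
have sA0 : 0 < Num.sqrt A by rewrite sqrtr_gt0.
have sB0 : 0 < Num.sqrt B by rewrite sqrtr_gt0.
have sxa0 : 0 < Num.sqrt (x - a) by rewrite sqrtr_gt0.
have sbx0 : 0 < Num.sqrt (b - x) by rewrite sqrtr_gt0.
have -> : b - a = (b - x) + (x - a) by ring.
rewrite /w.
move: (Num.sqrt A) (Num.sqrt B) (Num.sqrt (x - a)) (Num.sqrt (b - x)) sA0 sB0 sxa0 sbx0.
move: (x - a) (b - x) xa0 bx0 => X Y X0 Y0 sA sB sX sY sA0 sB0 sX0 sY0 <- <- <- <-.
have D0 : sA ^+ 2 * sY ^+ 2 + sB ^+ 2 * sX ^+ 2 != 0.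
  by rewrite gt_eqF// addr_gt0// mulr_gt0// exprn_gt0.
by field; rewrite !exprMn D0 !gt_eqF.
Qed.

Lemma atan_primitive_left a b A B : a < b ->
  atan_primitive a b A B x @[x --> a^'+] --> 0.
Proof.
move=> ab; have -> : 0 = atan_primitive a b A B a.
  by rewrite /atan_primitive subrr mul0r sqrtr0 mulr0 atan0 mulr0.
apply: cvg_at_right_filter; apply: cvgM; first exact: cvg_cst.
apply: (@continuous_comp _ _ _
  (fun x => Num.sqrt (B / A) * Num.sqrt ((x - a) / (b - x))) atan); last first.
  exact: continuous_atan.
apply: cvgM; first exact: cvg_cst.
apply: (@continuous_comp _ _ _ (fun x => (x - a) / (b - x)) Num.sqrt); last first.
  exact: sqrt_continuous.
apply: cvgM; first by apply: cvgB; [exact: cvg_id|exact: cvg_cst].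
apply: cvgV; first by rewrite gt_eqF// subr_gt0.
by apply: cvgB; [exact: cvg_cst|exact: cvg_id].
Qed.

Lemma atan_primitive_right a b A B : a < b -> 0 <= A -> 0 <= B ->
  atan_primitive a b A B x @[x --> b^'-] --> pi * Num.sqrt (A * B).
Proof.
move=> ab A0 B0.
have [AB0|AB0] := eqVneq (A * B) 0.
  rewrite AB0 sqrtr0 mulr0 (_ : atan_primitive a b A B = cst 0).
    exact: cvg_cst.
  by apply/funext => y; rewrite /atan_primitive AB0 sqrtr0 mulr0 mul0r.
have k0 : 0 < Num.sqrt (B / A).
  rewrite sqrtr_gt0 lt_neqAle divr_ge0// andbT eq_sym.
  by move: AB0; rewrite !mulf_eq0 invr_eq0 orbC.
have -> : pi * Num.sqrt (A * B) = 2 * Num.sqrt (A * B) * (pi / 2) by field.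
apply: cvgM; first exact: cvg_cst.
apply: (@cvg_comp _ _ _ (fun x => Num.sqrt (B / A) * Num.sqrt ((x - a) / (b - x)))
  atan _ _ _ _ (@cvgy_atan R)).
apply/cvgryPge => M; pose L : R := (Num.sqrt (B / A))^-1 * M.
have L0 : 0 < 2 * (L ^+ 2 + 1) by rewrite mulr_gt0// ltr_pwDr// sqr_ge0.
have e0 : 0 < (b - a) / (2 * (L ^+ 2 + 1)).
  by apply: divr_gt0; rewrite ?subr_gt0.
near=> x.
have xb : x < b by near: x; exact: nbhs_left_lt.
rewrite -ler_pdivrMl// -/L.
apply: le_trans (ler_norm L) _; rewrite -sqrtr_sqr ler_wsqrtr//.
rewrite ler_pdivlMr ?subr_gt0//.
have : b - (b - a) / (2 * (L ^+ 2 + 1)) < x.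
  by near: x; apply: nbhs_left_gt; rewrite ltrBlDr ltrDl.
rewrite ltrBlDr -ltrBlDl ltr_pdivlMr// => H.
have L2 : 0 <= L ^+ 2 by exact: sqr_ge0.
have bx : 0 < b - x by rewrite subr_gt0.
by have := mulr_ge0 L2 (ltW bx); lra.
Unshelve. all: by end_near. Qed.

End improper_integral.

(** * The Stieltjes transform of the limit density *)

Section limit_density_stieltjes.
Context {R : realType}.
Local Notation leb := (@lebesgue_measure R).
Variables p q : R.
Hypotheses (p1 : 1 <= p) (q1 : 1 <= q).
Local Notation a := (lambda_minus p q).
Local Notation b := (lambda_plus p q).
Implicit Types (x z : R).

Let u2_ge0 : 0 <= p / (p + q) * (1 - 1 / (p + q)).
Proof.
have := p1; have := q1 => q1' p1'.
apply: mulr_ge0; first by rewrite divr_ge0//; lra.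
by rewrite subr_ge0 ler_pdivrMr; lra.
Qed.

Let v2_ge0 : 0 <= 1 / (p + q) * (1 - p / (p + q)).
Proof.
have := p1; have := q1 => q1' p1'.
apply: mulr_ge0; first by rewrite divr_ge0//; lra.
by rewrite subr_ge0 ler_pdivrMr; lra.
Qed.

Lemma lambda_sum : a + b = 2 * (p * (p + q - 1) + q) / (p + q) ^+ 2.
Proof.
have := p1; have := q1 => q1' p1'.
rewrite /lambda_minus /lambda_plus sqrrB sqrrD !sqr_sqrtr//.
by field; lra.
Qed.

Lemma lambda_prod : a * b = ((p - 1) / (p + q)) ^+ 2.
Proof.
have := p1; have := q1 => q1' p1'.
rewrite /lambda_minus /lambda_plus -exprMn -subr_sqr !sqr_sqrtr//.
by congr (_ ^+ 2); field; lra.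
Qed.

Lemma lambda_prod1 : (1 - a) * (1 - b) = ((q - 1) / (p + q)) ^+ 2.
Proof.
have := p1; have := q1 => q1' p1'.
have -> : (1 - a) * (1 - b) = 1 - (a + b) + a * b by ring.
by rewrite lambda_sum lambda_prod; field; lra.
Qed.

Lemma lambda_lt : a < b.
Proof.
have := p1; have := q1 => q1' p1'.
rewrite -subr_gt0 /lambda_minus /lambda_plus.
set u := Num.sqrt _; set v := Num.sqrt _.
have -> : (u + v) ^+ 2 - (u - v) ^+ 2 = 4 * (u * v) by ring.
have pq : 0 < p + q by lra.
rewrite mulr_gt0// mulr_gt0// sqrtr_gt0 mulr_gt0// ?divr_gt0//; try lra.
  by rewrite subr_gt0 ltr_pdivrMr; lra.
by rewrite subr_gt0 ltr_pdivrMr; lra.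
Qed.

Lemma lambda_minus_ge0 : 0 <= a. Proof. exact: sqr_ge0. Qed.

(** (1 - a) (1 - b) >= 0 together with a + b < 2 excludes b > 1. *)
Lemma lambda_plus_le1 : b <= 1.
Proof.
have := p1; have := q1 => q1' p1'.
have H : 0 <= (1 - a) * (1 - b) by rewrite lambda_prod1 sqr_ge0.
have s2 : a + b < 2.
  rewrite lambda_sum ltr_pdivrMr; last by rewrite exprn_gt0//; lra.
  rewrite ltr_pM2l// expr2 -subr_gt0.
  have -> : (p + q) * (p + q) - (p * (p + q - 1) + q) = q * (p + q - 1) + p by ring.
  by rewrite ltr_pwDr// ?mulr_ge0//; lra.
rewrite leNgt; apply/negP => b1.
have a1 : a < 1 by move: s2 b1; set s := a; set t := b; lra.
have : (1 - a) * (1 - b) < 0 by rewrite pmulr_rlt0; rewrite ?subr_gt0// subr_lt0.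
by rewrite ltNge H.
Qed.

(** Inversion is discontinuous at 0, where 0^-1 = 0; the formula
    x |x| ^ -2 is valid at 0 too. *)
Lemma measurable_inv : measurable_fun setT (fun x : R => x^-1).
Proof.
have -> : (fun x : R => x^-1) = (fun x => x * (`|x| `^ (- 1)) ^+ 2).
  apply/funext => x; have [->|x0] := eqVneq x 0; first by rewrite invr0 mul0r.
  rewrite powRN powRr1// exprVn real_normK ?num_real//.
  by field.
apply: measurable_funM => //; apply: measurable_funX.
apply: (measurableT_comp (measurable_powR _)).
exact: normr_measurable.
Qed.

Definition bulk_density x : R :=
  (p + q) / (2 * pi) * (Num.sqrt (- (x - a) * (x - b)) / (x * (1 - x))).

Lemma limit_densityE x : limit_density p q x = bulk_density x * \1_(`[a, b]) x.
Proof. by []. Qed.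

Lemma measurable_bulk_density : measurable_fun setT bulk_density.
Proof.
apply: measurable_funM => //; apply: measurable_funM.
  have ms : measurable_fun setT (@Num.sqrt R).
    by apply: continuous_measurable_fun; exact: sqrt_continuous.
  apply: (measurableT_comp ms); apply: measurable_funM.
    by apply: measurableT_comp => //; apply: measurable_funB.
  exact: measurable_funB.
apply: (measurableT_comp measurable_inv); apply: measurable_funM => //.
exact: measurable_funB.
Qed.

Lemma measurable_limit_density : measurable_fun setT (limit_density p q).
Proof.
have -> : limit_density p q = (fun x => bulk_density x * \1_(`[a, b]) x).
  by apply/funext => x; exact: limit_densityE.
by apply: measurable_funM => //; exact: measurable_bulk_density.
Qed.

Lemma bulk_in01 x : a < x < b -> 0 < x < 1.
Proof.
have := lambda_minus_ge0; have := lambda_plus_le1.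
by move=> ? ? /andP[? ?]; apply/andP; split; lra.
Qed.

Lemma bulk_density_ge0 x : 0 <= x <= 1 -> 0 <= bulk_density x.
Proof.
have := p1; have := q1 => q1' p1'; move=> /andP[x0 x1].
apply: mulr_ge0; first by rewrite divr_ge0 ?mulr_ge0 ?pi_ge0//; lra.
by rewrite divr_ge0 ?sqrtr_ge0// mulr_ge0//; lra.
Qed.

Lemma limit_density_ge0 x : 0 <= x <= 1 -> 0 <= limit_density p q x.
Proof. by move=> x01; rewrite limit_densityE mulr_ge0// bulk_density_ge0. Qed.

Lemma integral_limit_density (h : R -> R) : measurable_fun setT h ->
  (\int[leb]_(x in `[0%R, 1%R]) (h x * limit_density p q x)%:E =
   \int[leb]_(x in `]a, b[) (h x * bulk_density x)%:E)%E.
Proof.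
move=> mh.
have -> : (\int[leb]_(x in `[0%R, 1%R]) (h x * limit_density p q x)%:E =
    \int[leb]_(x in `[0%R, 1%R])
      (((fun x => (h x * bulk_density x)%:E) \_ `[a, b]) x))%E.
  apply: eq_integral => x _; rewrite limit_densityE patchE indicE.
  by case: ifP => _; rewrite ?mulr1 ?mulr0 ?mulr0.
rewrite -integral_mkcondr (_ : _ `&` _ = `[a, b]%classic); last first.
  apply/setIidPr => x; rewrite /= !in_itv/=.
  have := lambda_minus_ge0; have := lambda_plus_le1.
  by move=> ? ? /andP[? ?]; apply/andP; split; apply: le_trans; eassumption.
rewrite (@integral_itv_bndoo _ a b _ true false)//; apply: measurable_funTS.
by apply/measurable_EFinP; apply: measurable_funM => //; exact: measurable_bulk_density.
Qed.

(** The nonnegative root of [loop_poly] for n1 / n and n2 / n tending to p and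
    q; see [limit_stieltjes_loop]. *)
Definition limit_stieltjes z : R :=
  ((p + q) * Num.sqrt ((z - a) * (z - b)) - (p - 1) * (z - 1) - (q - 1) * z) /
  (2 * (z * (z - 1))).

(** Partial fractions of (x - a) (b - x) / (x (1 - x) (z - x)) at the poles 0, 1
    and z split the integrand into three derivatives of arctangents. *)
Lemma integral_bulk_stieltjes z : 1 < z ->
  (\int[leb]_(x in `]a, b[) ((z - x)^-1 * bulk_density x)%:E =
   (limit_stieltjes z)%:E)%E.
Proof.
have := p1; have := q1 => q1' p1' z1.
have ab := lambda_lt; have a0 := lambda_minus_ge0; have b1 := lambda_plus_le1.
have za : 0 <= z - a by lra.
have zb : 0 <= z - b by lra.
have a1 : 0 <= 1 - a by lra.
have b1' : 0 <= 1 - b by lra.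
have b0 : 0 <= b by lra.
have pi0 : 0 < pi :> R := pi_gt0 R.
pose C : R := (p + q) / (2 * pi).
pose F x := C * (atan_primitive a b (z - a) (z - b) x / (z * (z - 1)) -
  atan_primitive a b a b x / z -
  atan_primitive a b (1 - a) (1 - b) x / (z - 1)).
pose l : R := C * (pi * Num.sqrt ((z - a) * (z - b)) / (z * (z - 1)) -
  pi * Num.sqrt (a * b) / z - pi * Num.sqrt ((1 - a) * (1 - b)) / (z - 1)).
have -> : limit_stieltjes z = l - 0.
  rewrite /l subr0 lambda_prod lambda_prod1 !sqrtr_sqr !ger0_norm.
  - by rewrite /limit_stieltjes /C; field; lra.
  - by rewrite divr_ge0//; lra.
  - by rewrite divr_ge0//; lra.
have H := @ge0_FTC_itvoo R (fun x => (z - x)^-1 * bulk_density x) F a b 0 l ab.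
apply: H.
- move=> x xab; have /andP[x0 x1] := bulk_in01 xab.
  rewrite mulr_ge0 ?invr_ge0 ?bulk_density_ge0//; first by lra.
  by apply/andP; split; lra.
- move=> x xab; have /andP[x0 x1] := bulk_in01 xab.
  apply: cvgM.
    apply: cvgV; first by lra.
    by apply: cvgB; [exact: cvg_cst|exact: cvg_id].
  apply: cvgM; first exact: cvg_cst.
  apply: cvgM.
    apply: (@continuous_comp _ _ _ (fun x => - (x - a) * (x - b)) Num.sqrt).
      by apply: cvgM; [apply: cvgN|]; apply: cvgB; (exact: cvg_id || exact: cvg_cst).
    exact: sqrt_continuous.
  apply: cvgV; first by rewrite mulf_neq0//; lra.
  apply: cvgM; first exact: cvg_id.
  by apply: cvgB; [exact: cvg_cst|exact: cvg_id].
- move=> x xab; have /andP[x0 x1] := bulk_in01 xab.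
  have dz := atan_primitive_derive xab za zb.
  have d0 := atan_primitive_derive xab a0 b0.
  have d1 := atan_primitive_derive xab a1 b1'.
  have Zz := is_deriveZ (z * (z - 1))^-1 dz.
  have Z0 := is_deriveZ z^-1 d0.
  have Z1 := is_deriveZ (z - 1)^-1 d1.
  have dF := is_deriveZ C (is_deriveB (is_deriveB Zz Z0) Z1).
  have FE : F = C \*: ((z * (z - 1))^-1 \*: atan_primitive a b (z - a) (z - b) -
      z^-1 \*: atan_primitive a b a b -
      (z - 1)^-1 \*: atan_primitive a b (1 - a) (1 - b)).
    apply/funext => y; rewrite /F /=; congr (_ * _).
    rewrite !fctE /GRing.scale/=; congr (_ - _ - _); exact: mulrC.
  rewrite FE; apply: is_derive_eq; rewrite /GRing.scale/=.
  have := xab => /andP[ax xb].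
  have r0 : 0 < (x - a) * (b - x) by rewrite mulr_gt0// subr_gt0.
  have -> : (z - a) * (b - x) + (z - b) * (x - a) = (b - a) * (z - x) by ring.
  have -> : a * (b - x) + b * (x - a) = (b - a) * x by ring.
  have -> : (1 - a) * (b - x) + (1 - b) * (x - a) = (b - a) * (1 - x) by ring.
  rewrite /bulk_density -/C.
  have -> : - (x - a) * (x - b) = (x - a) * (b - x) by ring.
  set r := Num.sqrt _.
  have rr : 0 < r by rewrite sqrtr_gt0.
  have -> : r / (x * (1 - x)) = (x - a) * (b - x) / r / (x * (1 - x)).
    by rewrite -(sqr_sqrtr (ltW r0)) -/r expr2 mulfK// gt_eqF.
  by field; rewrite (gt_eqF rr)/=; move: ab; set s := a; set t := b; lra.
- rewrite -(mulr0 C) -[X in C * X](subr0 0) -[X in C * (X - 0)](subr0 0).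
  apply: cvgM; first exact: cvg_cst.
  have L A B c : atan_primitive a b A B x / c @[x --> a^'+] --> (0 : R).
    rewrite -(mul0r c^-1); apply: cvgM; last exact: cvg_cst.
    exact: atan_primitive_left.
  by apply: cvgB; [apply: cvgB|]; exact: L.
- apply: cvgM; first exact: cvg_cst.
  have L A B c : 0 <= A -> 0 <= B -> atan_primitive a b A B x / c @[x --> b^'-]
      --> (pi * Num.sqrt (A * B) / c : R).
    move=> A0 B0; apply: cvgM; last exact: cvg_cst.
    exact: atan_primitive_right.
  by apply: cvgB; [apply: cvgB|]; exact: L.
Qed.

Lemma limit_stieltjes_ge0 z : 1 < z -> 0 <= limit_stieltjes z.
Proof.
move=> z1; rewrite -lee_fin -integral_bulk_stieltjes//.
apply: integral_ge0 => x; rewrite /= in_itv/= => xab.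
have /andP[x0 x1] := bulk_in01 xab.
rewrite lee_fin mulr_ge0 ?invr_ge0 ?bulk_density_ge0//; first by lra.
by apply/andP; split; lra.
Qed.

(** With D ^ 2 = (z - a) (z - b), D being the square root in the formula, this is
    the solution formula of the quadratic equation. *)
Lemma limit_stieltjes_loop z : 1 < z ->
  loop_poly z (p + q - 1)^-1 ((p - 1) / (p + q - 1)) (limit_stieltjes z) = 0.
Proof.
have := p1; have := q1 => q1' p1' z1.
have ab := lambda_lt; have a0 := lambda_minus_ge0; have b1 := lambda_plus_le1.
rewrite /loop_poly /limit_stieltjes.
have : Num.sqrt ((z - a) * (z - b)) ^+ 2 = z ^+ 2 - (a + b) * z + a * b.
  by rewrite sqr_sqrtr; [ring|rewrite mulr_ge0//; lra].
rewrite lambda_sum lambda_prod; set D := Num.sqrt _ => DE.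
have z2 : 0 < z * (z - 1) by rewrite mulr_gt0//; lra.
transitivity (((p + q) ^+ 2 * D ^+ 2 - ((p - 1) * (z - 1) + (q - 1) * z) ^+ 2 -
    4 * (z * (z - 1)) * (p + q - 1)) / (4 * (z * (z - 1)) * (p + q - 1))).
  by field; lra.
by rewrite DE; field; lra.
Qed.

Lemma Rintegral_stieltjes z : 1 < z ->
  \int[leb]_(x in `[0%R, 1%R]) ((z - clamp01 x)^-1 * limit_density p q x) =
  limit_stieltjes z.
Proof.
move=> z1; rewrite /Rintegral integral_limit_density; last first.
  by apply: continuous_measurable_fun; exact: continuous_inv_clamp01.
rewrite -[RHS]/(fine (limit_stieltjes z)%:E) -integral_bulk_stieltjes//.
congr fine; apply: eq_integral => x; rewrite inE/= in_itv/= => /bulk_in01/andP[x0 x1].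
by rewrite clamp01_id//; apply/andP; split; lra.
Qed.

(** The density is at most twice the integrand of its Stieltjes transform at 2. *)
Lemma integrable_limit_density :
  leb.-integrable `[0, 1] (EFin \o limit_density p q).
Proof.
have z1 : 1 < 2 :> R by lra.
have mL := measurable_limit_density.
apply/integrableP; split; first by apply/measurable_EFinP; exact: measurable_funTS.
apply: (@le_lt_trans _ _ (\int[leb]_(x in `[0%R, 1%R])
    (2%:E * ((2 - clamp01 x)^-1 * limit_density p q x)%:E))%E).
  apply: ge0_le_integral => //.
  - by apply: measurableT_comp => //; apply/measurable_EFinP; exact: measurable_funTS.
  - apply: measurable_funeM; apply/measurable_EFinP; apply: measurable_funTS.
    apply: measurable_funM => //.
    by apply: continuous_measurable_fun; exact: continuous_inv_clamp01.
  move=> x; rewrite /= in_itv/= => x01; have /andP[x0 x1] := x01.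
  rewrite lee_fin clamp01_id// ger0_norm ?limit_density_ge0// mulrA.
  rewrite ler_peMl ?limit_density_ge0// ler_pdivlMr; lra.
rewrite ge0_integralZl//.
- rewrite integral_limit_density; last first.
    by apply: continuous_measurable_fun; exact: continuous_inv_clamp01.
  have -> : (\int[leb]_(x in `]a, b[) ((2 - clamp01 x)^-1 * bulk_density x)%:E =
      \int[leb]_(x in `]a, b[) ((2 - x)^-1 * bulk_density x)%:E)%E; last first.
    by rewrite integral_bulk_stieltjes// -EFinM ltry.
  apply: eq_integral => x; rewrite inE/= in_itv/= => /bulk_in01/andP[x0 x1].
  by rewrite clamp01_id//; apply/andP; split; lra.
- apply/measurable_EFinP; apply: measurable_funTS.
  apply: measurable_funM => //.
  by apply: continuous_measurable_fun; exact: continuous_inv_clamp01.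
- move=> x; rewrite /= in_itv/= => x01; have /andP[x0 x1] := x01.
  by rewrite lee_fin clamp01_id// mulr_ge0 ?invr_ge0 ?limit_density_ge0//; lra.
Qed.

Lemma integrable_mul_limit_density (h : R -> R) : continuous h ->
  leb.-integrable `[0, 1] (EFin \o (fun x => h x * limit_density p q x)).
Proof.
move=> ch; have := @integrableMr _ (measurableTypeR R) R leb `[0, 1]%classic
  (measurable_itv _) h (EFin \o limit_density p q); apply.
- by apply: measurable_funTS; exact: continuous_measurable_fun.
- have /compact_bounded[M [_ hM]] :=
    continuous_compact (continuous_subspaceT ch) (@segment_compact R 0 1).
  exists M; split; first exact: num_real.
  by move=> t Mt x x01; apply: hM => //; exists x.
- exact: integrable_limit_density.
Qed.

Definition limit_integral (h : R -> R) : R :=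
  \int[leb]_(x in `[0%R, 1%R]) (h x * limit_density p q x).

Lemma limit_integral_linear (c d : R) (f g : R -> R) :
  continuous f -> continuous g ->
  limit_integral (fun x => c * f x + d * g x) =
  c * limit_integral f + d * limit_integral g.
Proof.
move=> cf cg; rewrite /limit_integral.
have intZ (k : R) (h : R -> R) : continuous h -> leb.-integrable `[0, 1]
    (EFin \o (fun x => k * (h x * limit_density p q x))).
  move=> ch.
  have := @integrable_mul_limit_density (fun x => k * h x).
  rewrite (_ : (fun x => k * h x * _) = (fun x => k * (h x * limit_density p q x))).
    by apply => x; apply: cvgM; [exact: cvg_cst|exact: ch].
  by apply/funext => x; rewrite mulrA.
rewrite -!RintegralZl//; [|exact: integrable_mul_limit_density..].
rewrite -RintegralD//; [|exact: intZ..].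
by apply: eq_Rintegral => x _; rewrite mulrDl !mulrA.
Qed.

Lemma limit_integral_le (f : R -> R) (e : R) : continuous f ->
  (forall x, 0 <= x <= 1 -> `|f x| <= e) ->
  `|limit_integral f| <= limit_integral (cst 1) * e.
Proof.
move=> cf fe; rewrite /limit_integral.
apply: le_trans (le_normr_Rintegral _ (integrable_mul_limit_density cf)) _ => //.
rewrite mulrC -RintegralZl//; last first.
  by apply: integrable_mul_limit_density => x; exact: cvg_cst.
apply: le_Rintegral => //.
- have := @integrable_mul_limit_density (fun x => `|f x|).
  have ca : continuous (fun x => `|f x|) by move=> x; apply: cvg_norm; exact: cf.
  move=> /(_ ca); apply: eq_integrable => // x; rewrite inE/= in_itv/= => x01.
  by rewrite normrM (ger0_norm (limit_density_ge0 x01)).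
- have := @integrable_mul_limit_density (cst e).
  have ca : continuous (cst e : R -> R) by move=> x; exact: cvg_cst.
  move=> /(_ ca); apply: eq_integrable => // x _.
  by rewrite /= mul1r.
- move=> x; rewrite /= in_itv/= => x01.
  rewrite normrM (ger0_norm (limit_density_ge0 x01)) mul1r.
  by apply: ler_wpM2r; [exact: limit_density_ge0|exact: fe].
Qed.

End limit_density_stieltjes.

(** * Limits of the normalized parameters *)

Section parameters.
Context {R : realType}.
Implicit Types (p q lambda x : R).

Lemma bulk_parameters (n1 n2 : nat -> R) p q : p + q - 1 != 0 ->
  n1 n / n%:R @[n --> \oo] --> p -> n2 n / n%:R @[n --> \oo] --> q ->
  n%:R / (n1 n + n2 n - n%:R) @[n --> \oo] --> (p + q - 1)^-1 /\
  (n1 n - n%:R) / (n1 n + n2 n - n%:R) @[n --> \oo] --> (p - 1) / (p + q - 1).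
Proof.
move=> pq0 c1 c2.
have cal : n%:R / (n1 n + n2 n - n%:R) @[n --> \oo] --> (p + q - 1)^-1.
  have c3 : (n1 n / n%:R + n2 n / n%:R - 1)^-1 @[n --> \oo] --> (p + q - 1)^-1.
    by apply: cvgV => //; apply: cvgB; [exact: cvgD|exact: cvg_cst].
  apply: cvg_trans c3; apply: near_eq_cvg; near=> n.
  have n0 : n%:R != 0 :> R by rewrite pnatr_eq0 -lt0n; near: n; exact: nbhs_infty_gt.
  by apply: invr_inj; rewrite invrK invf_div; field.
split=> //.
have c3 : (n1 n / n%:R - 1) * (n%:R / (n1 n + n2 n - n%:R)) @[n --> \oo]
    --> (p - 1) / (p + q - 1).
  by apply: cvgM => //; apply: cvgB => //; exact: cvg_cst.
apply: cvg_trans c3; apply: near_eq_cvg; near=> n.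
have n0 : n%:R != 0 :> R by rewrite pnatr_eq0 -lt0n; near: n; exact: nbhs_infty_gt.
by rewrite mulrA mulrBl divfK// mul1r.
Unshelve. all: by end_near. Qed.

Lemma fast_parameters (n1 n2 : nat -> R) lambda :
  (n1 n + n2 n - 2 * n%:R) / n%:R @[n --> \oo] --> +oo ->
  (n1 n - n%:R) / (n1 n + n2 n - 2 * n%:R) @[n --> \oo] --> lambda ->
  n%:R / (n1 n + n2 n - n%:R) @[n --> \oo] --> (0 : R) /\
  (n1 n - n%:R) / (n1 n + n2 n - n%:R) @[n --> \oo] --> lambda.
Proof.
move=> coo cl.
have cal : n%:R / (n1 n + n2 n - n%:R) @[n --> \oo] --> (0 : R).
  have c3 : ((n1 n + n2 n - 2 * n%:R) / n%:R + 1)^-1 @[n --> \oo] --> (0 : R).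
    apply/gtr0_cvgV0.
      near=> n; have : 0 < (n1 n + n2 n - 2 * n%:R) / n%:R.
        by near: n; move/cvgryPgt : coo; exact.
      by move=> h; rewrite addr_gt0.
    apply/cvgryPge => A; near=> n.
    have : A <= (n1 n + n2 n - 2 * n%:R) / n%:R.
      by near: n; move/cvgryPge : coo; exact.
    by move/le_trans; apply; rewrite lerDl.
  apply: cvg_trans c3; apply: near_eq_cvg; near=> n.
  have n0 : n%:R != 0 :> R by rewrite pnatr_eq0 -lt0n; near: n; exact: nbhs_infty_gt.
  by apply: invr_inj; rewrite invrK invf_div; field.
split=> //.
have c3 : ((n1 n - n%:R) / (n1 n + n2 n - 2 * n%:R)) *
    (1 - n%:R / (n1 n + n2 n - n%:R)) @[n --> \oo] --> lambda.
  rewrite -[X in _ --> X]mulr1 -[X in _ * X]subr0.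
  by apply: cvgM => //; apply: cvgB => //; exact: cvg_cst.
apply: cvg_trans c3; apply: near_eq_cvg; near=> n.
have n0 : 0 < n%:R :> R by rewrite ltr0n; near: n; exact: nbhs_infty_gt.
have s0 : 0 < (n1 n + n2 n - 2 * n%:R) / n%:R.
  by near: n; move/cvgryPgt : coo; exact.
have {}s0 : 0 < n1 n + n2 n - 2 * n%:R by move: s0; rewrite pmulr_lgt0// invr_gt0.
by field; apply/andP; split; lra.
Unshelve. all: by end_near. Qed.

Lemma cvg_natV : (n%:R^-1 : R) @[n --> \oo] --> (0 : R).
Proof.
apply/gtr0_cvgV0; last exact: cvgr_idn.
by near=> n; rewrite ltr0n; near: n; exact: nbhs_infty_gt.
Unshelve. all: by end_near. Qed.

(** From n1 / n + 1 / n >= 1 in the limit. *)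
Lemma parameter_ge1 (n1 : nat -> R) p : (forall n, (0 < n)%N -> n%:R - 1 < n1 n) ->
  n1 n / n%:R @[n --> \oo] --> p -> 1 <= p.
Proof.
move=> hn1 c1.
have c2 : n1 n / n%:R + n%:R^-1 @[n --> \oo] --> p.
  by rewrite -[X in _ --> X]addr0; apply: cvgD => //; exact: cvg_natV.
apply: (cvgr_to_ge c2); near=> n.
have n0 : (0 < n)%N by near: n; exact: nbhs_infty_gt.
have -> : n1 n / n%:R + n%:R^-1 = (n1 n + 1) / n%:R by ring.
rewrite ler_pdivlMr ?ltr0n//.
by have := hn1 _ n0; lra.
Unshelve. all: by end_near. Qed.

Lemma fast_parameter_le1 (n1 n2 : nat -> R) lambda :
  (forall n, (0 < n)%N -> n%:R - 1 < n1 n) ->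
  (forall n, (0 < n)%N -> n%:R - 1 < n2 n) ->
  (n1 n + n2 n - 2 * n%:R) / n%:R @[n --> \oo] --> +oo ->
  (n1 n - n%:R) / (n1 n + n2 n - 2 * n%:R) @[n --> \oo] --> lambda ->
  0 <= lambda <= 1.
Proof.
move=> hn1 hn2 coo cl.
have c0 := @cvg_natV.
have big : \forall n \near \oo, n%:R <= n1 n + n2 n - 2 * n%:R /\ (0 < n)%N.
  near=> n; have n0 : (0 < n)%N by near: n; exact: nbhs_infty_gt.
  split=> //; have : 1 <= (n1 n + n2 n - 2 * n%:R) / n%:R.
    by near: n; move/cvgryPge : coo; exact.
  by rewrite ler_pdivlMr ?ltr0n// mul1r.
apply/andP; split.
- have c2 : (n1 n - n%:R) / (n1 n + n2 n - 2 * n%:R) + n%:R^-1 @[n --> \oo] --> lambda.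
    by rewrite -[X in _ --> X]addr0; apply: cvgD.
  apply: (cvgr_to_ge c2); near=> n.
  have [sn n0] : n%:R <= n1 n + n2 n - 2 * n%:R /\ (0 < n)%N by near: n.
  have n0' : 0 < n%:R :> R by rewrite ltr0n.
  have s0 : 0 < n1 n + n2 n - 2 * n%:R by lra.
  have h1 := hn1 _ n0.
  rewrite -lerBlDr sub0r ler_pdivlMr// mulNr lerNl.
  apply: (@le_trans _ _ 1); first by lra.
  by rewrite mulrC ler_pdivlMr// mul1r.
- have c2 : (n1 n - n%:R) / (n1 n + n2 n - 2 * n%:R) - n%:R^-1 @[n --> \oo] --> lambda.
    by rewrite -[X in _ --> X]subr0; apply: cvgB.
  apply: (cvgr_to_le c2); near=> n.
  have [sn n0] : n%:R <= n1 n + n2 n - 2 * n%:R /\ (0 < n)%N by near: n.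
  have n0' : 0 < n%:R :> R by rewrite ltr0n.
  have s0 : 0 < n1 n + n2 n - 2 * n%:R by lra.
  have h2 := hn2 _ n0.
  rewrite lerBlDr ler_pdivrMr// mulrDl mul1r.
  have : 1 <= n%:R^-1 * (n1 n + n2 n - 2 * n%:R) by rewrite mulrC ler_pdivlMr// mul1r.
  by lra.
Unshelve. all: by end_near. Qed.

(** Since n1 - n and n2 - n both exceed -1, their sum being small makes each of
    them small. *)
Lemma slow_parameter (n1 n2 : nat -> R) :
  (forall n, (0 < n)%N -> n%:R - 1 < n1 n) ->
  (forall n, (0 < n)%N -> n%:R - 1 < n2 n) ->
  (fun n => n1 n + n2 n - 2 * n%:R) =o_\oo (fun n => n%:R : R) ->
  n1 n / n%:R @[n --> \oo] --> (1 : R).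
Proof.
move=> hn1 hn2 /eqoP small; apply/cvgrPdist_le => e e0.
have e2 : 0 < e / 2 by lra.
near=> n.
have n0 : (0 < n)%N by near: n; exact: nbhs_infty_gt.
have n0' : 0 < n%:R :> R by rewrite ltr0n.
have sn : `|n1 n + n2 n - 2 * n%:R| <= e / 2 * `|n%:R : R|.
  by near: n; exact: small.
have /andP[h4 h5] : - (e / 2 * n%:R) <= n1 n + n2 n - 2 * n%:R <= e / 2 * n%:R.
  by rewrite -ler_norml; move: sn; rewrite (ger0_norm (ltW n0')).
have : (e / 2)^-1 <= n%:R by near: n; exact: nbhs_infty_ger.
rewrite -[(e / 2)^-1]mul1r ler_pdivrMr// => h1.
have h2 := hn1 _ n0; have h3 := hn2 _ n0.
have -> : 1 - n1 n / n%:R = (n%:R - n1 n) / n%:R by field; rewrite gt_eqF.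
rewrite ler_norml; apply/andP; split.
  by rewrite ler_pdivlMr//; lra.
by rewrite ler_pdivrMr//; lra.
Unshelve. all: by end_near. Qed.

(** The density for p = q = 1 is the arcsine density; at 0 and 1 both sides are 0
    because x / 0 = 0. *)
Lemma limit_density11 x : limit_density 1 1 x =
  pi^-1 * (\1_(`[0, 1]) x / Num.sqrt (x * (1 - x))) :> R.
Proof.
have half : 1 / (1 + 1) * (1 - 1 / (1 + 1)) = (2^-1) ^+ 2 :> R by field.
have lm : lambda_minus 1 1 = 0 :> R by rewrite /lambda_minus subrr expr0n.
have lp : lambda_plus 1 1 = 1 :> R.
  by rewrite /lambda_plus half sqrtr_sqr ger0_norm ?invr_ge0//; field.
rewrite /limit_density lm lp subr0 indicE.
have [x01|_] := boolP (x \in _); last by rewrite !mulr0 mul0r mulr0.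
have -> : - x * (x - 1) = x * (1 - x) by ring.
move: x01; rewrite inE/= in_itv/= => /andP[x0 x1].
have w0 : 0 <= x * (1 - x) by rewrite mulr_ge0// subr_ge0.
set w := x * (1 - x) in w0 *.
have -> : Num.sqrt w / w = (Num.sqrt w)^-1.
  have [->|s0] := eqVneq w 0; first by rewrite sqrtr0 invr0 mulr0.
  have sw : Num.sqrt w != 0 by rewrite sqrtr_eq0 -ltNge lt_neqAle eq_sym s0.
  by rewrite -{2}(sqr_sqrtr w0) expr2 invfM mulrA mulfV// mul1r.
have : pi != 0 :> R by rewrite gt_eqF// pi_gt0.
move: (@pi R) (Num.sqrt w)^-1 => c s c0; rewrite mulr1 mul1r; field; exact: c0.
Qed.

End parameters.

Theorem proposition1p1 (R : realType) (beta : R) (hbeta : 0 < beta)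
    (n1 n2 : nat -> R)
    (hn1 : forall n, (0 < n)%N -> n%:R - 1 < n1 n)
    (hn2 : forall n, (0 < n)%N -> n%:R - 1 < n2 n)
    (d : nat -> measure_display) (T : forall n, measurableType (d n))
    (P : forall n, probability (T n) R)
    (X : forall n, {RV (P n) >-> n.-tuple (measurableTypeR R)})
    (hX01 : forall n, (0 < n)%N -> forall w, unit_cube (X n w))
    (hXlaw : forall n, (0 < n)%N -> forall A, measurable A ->
       distribution (P n) (X n) A = jacobi_ensemble (n1 n) (n2 n) beta A)
    (f : R -> R) (hf : {within `[0, 1], continuous f}) :
  [/\ ((fun n => n1 n + n2 n - 2 * n%:R) =o_\oo (fun n => n%:R : R)) ->
      cvg_in_probability P (fun n w => empirical_mean f (X n w))
        (pi^-1 * \int[lebesgue_measure]_(x in `[0, 1])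
                   (f x / Num.sqrt (x * (1 - x)))),
      forall p q : R,
        n1 n / n%:R @[n --> \oo] --> p ->
        n2 n / n%:R @[n --> \oo] --> q ->
        cvg_in_probability P (fun n w => empirical_mean f (X n w))
          (\int[lebesgue_measure]_(x in `[0, 1]) (f x * limit_density p q x))
    & forall lambda : R,
        (n1 n + n2 n - 2 * n%:R) / n%:R @[n --> \oo] --> +oo ->
        (n1 n - n%:R) / (n1 n + n2 n - 2 * n%:R) @[n --> \oo] --> lambda ->
        cvg_in_probability P (fun n w => empirical_mean f (X n w))
          (f lambda)].
Proof.
have bulk (p q : R) : n1 n / n%:R @[n --> \oo] --> p -> n2 n / n%:R @[n --> \oo] --> q ->
    1 <= p /\ 1 <= q /\ cvg_in_probability P
      (fun n w => empirical_mean f (X n w)) (limit_integral p q (f \o clamp01)).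
  move=> c1 c2; have p1 := parameter_ge1 hn1 c1; have q1 := parameter_ge1 hn2 c2.
  have pq0 : 0 < p + q - 1 by lra.
  have [cal cga] := bulk_parameters (lt0r_neq0 pq0) c1 c2.
  split=> //; split=> //.
  apply: (linear_statistics_cvg hX01 _ (limit_integral_le p1 q1)) => // [|z z1].
    exact: limit_integral_linear.
  (* The limit of the Stieltjes means is the root of the loop polynomial. *)
  rewrite /limit_integral Rintegral_stieltjes//.
  apply: (stieltjes_cvg hbeta hn1 hn2 hX01 hXlaw z1 _ _ _ _ cal cga).
  - by rewrite invr_ge0 ltW.
  - have -> : (p + q - 1)^-1 + (p - 1) / (p + q - 1) = p / (p + q - 1) by ring.
    by rewrite ler_pdivrMr//; lra.
  - exact: limit_stieltjes_ge0.
  - exact: limit_stieltjes_loop.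
have noclamp (p q : R) : limit_integral p q (f \o clamp01) =
    \int[lebesgue_measure]_(x in `[0, 1]) (f x * limit_density p q x).
  apply: eq_Rintegral => x; rewrite inE/= in_itv/= => x01.
  by rewrite clamp01_id.
split.
- move=> small.
  have c1 := slow_parameter hn1 hn2 small.
  have c2 : n2 n / n%:R @[n --> \oo] --> (1 : R).
    apply: (slow_parameter hn2 hn1); rewrite (_ : (fun n => _) =
      (fun n => n1 n + n2 n - 2 * n%:R))//.
    by apply/funext => n; rewrite (addrC (n2 n)).
  have [p1 [q1 cf]] := bulk _ _ c1 c2.
  rewrite (_ : pi^-1 * _ = limit_integral 1 1 (f \o clamp01))//.
  have p0 : pi != 0 :> R by rewrite gt_eqF// pi_gt0.
  rewrite noclamp (_ : Rintegral _ _ _ = pi *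
    \int[lebesgue_measure]_(x in `[0, 1]) (f x * limit_density 1 1 x)).
    by rewrite mulrA mulVf// mul1r.
  rewrite -noclamp /limit_integral -RintegralZl//; last first.
    exact/integrable_mul_limit_density/continuous_comp_clamp01.
  apply: eq_Rintegral => x xin.
  have x01 : 0 <= x <= 1 by move: xin; rewrite inE/= in_itv.
  rewrite /= clamp01_id// limit_density11 indicE xin mul1r.
  by rewrite mulrCA mulVKf.
- by move=> p q c1 c2; have [_ [_ cf]] := bulk _ _ c1 c2; rewrite -noclamp.
- move=> lambda coo cl.
  have l01 := fast_parameter_le1 hn1 hn2 coo cl.
  have [cal cga] := fast_parameters coo cl.
  have /andP[l0 l1] := l01.
  rewrite -[f lambda]/(f lambda) -{1}(clamp01_id l01).
  apply: (linear_statistics_cvg (Lam := fun g => g lambda) (CLam := 1) hX01) => //.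
    by move=> g e _ ge; rewrite mul1r; exact: ge.
  move=> z z1; rewrite clamp01_id//.
  apply: (stieltjes_cvg hbeta hn1 hn2 hX01 hXlaw z1 _ _ _ _ cal cga) => //.
  - by rewrite add0r.
  - by rewrite invr_ge0; lra.
  - by rewrite /loop_poly; field; lra.
Qed.
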